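(* Let $v$ be a measurable, locally square-summable $m_1\times m_2$ matrix function on $[0,\infty)$, consider the Dirac system $\frac{d}{dx}y(x,z)=\mathrm{i}(zj+jV(x))y(x,z)$ on $[0,\infty)$ with potential $v$, and let $\varphi$ be the Weyl function of this system. Then $v$ is uniquely recovered from $\varphi$; that is, if two Dirac systems on $[0,\infty)$ (with the same $m_1,m_2$) with locally square-summable potentials $v$ and $\widehat v$ have the same Weyl function, then $v=\widehat v$ almost everywhere on $[0,\infty)$.
   Context: Let $m_1,m_2\ge 1$ be integers, $m=m_1+m_2$, $j=\begin{bmatrix} I_{m_1}&0\\0&-I_{m_2}\end{bmatrix}$ and $V(x)=\begin{bmatrix}0&v(x)\\ v(x)^*&0\end{bmatrix}$, where $v$ is an $m_1\times m_2$ complex matrix function (the potential). A matrix function is summable (square-summable) if its entries are; locally square-summable on $[0,\infty)$ means square-summable on every finite interval $[0,l]$. $u(x,z)$ is the fundamental ($m\times m$) solution of the Dirac system $\frac{d}{dx}y(x,z)=\mathrm{i}(zj+jV(x))y(x,z)$, $x\ge 0$, normalized by $u(0,z)=I_m$; $\mathbb{C}_+$ is the open upper half-plane. A Weyl function of the Dirac system on $[0,\infty)$ is a holomorphic $m_2\times m_1$ matrix function $\varphi$ on $\mathbb{C}_+$ such that $$\int_0^\infty \begin{bmatrix} I_{m_1}&\varphi(z)^*\end{bmatrix}u(x,z)^*u(x,z)\begin{bmatrix} I_{m_1}\\ \varphi(z)\end{bmatrix}dx<\infty,\quad z\in\mathbb{C}_+.$$ It is known that (for locally summable $v$) there is exactly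 one such function, so one speaks of the Weyl function. *)

(* Defs.v *)
From HB Require Import structures.
From mathcomp Require Import all_boot all_order all_algebra.
From mathcomp Require Import all_classical all_reals all_analysis.
From mathcomp Require Import complex.

Set Implicit Arguments.
Unset Strict Implicit.
Unset Printing Implicit Defensive.

Import Order.TTheory GRing.Theory Num.Theory.
Import numFieldNormedType.Exports.
Local Open Scope classical_set_scope.
Local Open Scope ring_scope.

(* The real line with its Lebesgue (not merely Borel) measurable sets; it is
   the type on which completed_lebesgue_measure is a measure. *)
Definition lebesgueType (R : realType) :=
  caratheodory_type (@wlength R idfun)^*%mu.

Notation leb R := (@completed_lebesgue_measure R).

Definition entrywise (R : realType) (m n : nat) (P : (R -> R) -> Prop)
    (A : R -> 'M[R[i]]_(m, n)) : Prop :=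
  forall i j, P (fun x => complex.Re (A x i j)) /\
              P (fun x => complex.Im (A x i j)).

Definition mx_measurable (R : realType) (m n : nat) (D : set R)
    (A : R -> 'M[R[i]]_(m, n)) : Prop :=
  entrywise (fun f => measurable_fun (D : set (lebesgueType R)) f) A.

Definition mx_summable (R : realType) (m n : nat) (D : set R)
    (A : R -> 'M[R[i]]_(m, n)) : Prop :=
  entrywise (fun f => (leb R).-integrable D (EFin \o f)) A.

(* Normc.normc is the R-valued modulus; the norm `|z| of z : R[i] lies in R[i]. *)
Definition mx_locally_square_summable (R : realType) (m n : nat)
    (A : R -> 'M[R[i]]_(m, n)) : Prop :=
  forall (l : R) i j,
    (leb R).-integrable `[0, l] (fun x => (Normc.normc (A x i j) ^+ 2)%:E).

Definition abs_continuous (R : realType) (a b : R) (f : R -> R) : Prop :=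
  forall e : R, 0 < e -> exists2 d : R, 0 < d &
    forall (n : nat) (s t : 'I_n -> R),
      (forall k, a <= s k /\ s k <= t k /\ t k <= b) ->
      trivIset [set: 'I_n] (fun k => `]s k, t k[%classic) ->
      \sum_(k < n) (t k - s k) < d ->
      \sum_(k < n) `|f (t k) - f (s k)| < e.

Definition mx_is_derive (R : realType) (m n : nat) (A : R -> 'M[R[i]]_(m, n))
    (x : R) (B : 'M[R[i]]_(m, n)) : Prop :=
  forall i j,
    is_derive x 1 (fun t => complex.Re (A t i j)) (complex.Re (B i j)) /\
    is_derive x 1 (fun t => complex.Im (A t i j)) (complex.Im (B i j)).

Definition adjmx (R : realType) (m n : nat) (A : 'M[R[i]]_(m, n)) :
  'M[R[i]]_(n, m) := map_mx conjc A^T.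

Definition dirac_j (R : realType) (m1 m2 : nat) : 'M[R[i]]_(m1 + m2) :=
  block_mx 1%:M 0 0 (- 1%:M).

Definition dirac_V (R : realType) (m1 m2 : nat) (v : R -> 'M[R[i]]_(m1, m2))
    (x : R) : 'M[R[i]]_(m1 + m2) :=
  block_mx 0 (v x) (adjmx (v x)) 0.

(* Solutions are understood in the Caratheodory sense: v being only locally
   summable, y is locally absolutely continuous on [0, +oo[ and satisfies
   y' = i (z j + j V) y almost everywhere there. *)
Definition dirac_solution (R : realType) (m1 m2 n : nat)
    (v : R -> 'M[R[i]]_(m1, m2)) (z : R[i]) (y : R -> 'M[R[i]]_(m1 + m2, n)) :
    Prop :=
  (forall l : R, entrywise (abs_continuous 0 l) y) /\
  {ae leb R, forall x : R, 0 < x ->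
     mx_is_derive y x
       ('i%C *: ((z *: dirac_j R m1 m2 + dirac_j R m1 m2 *m dirac_V v x)
                 *m y x))}.

Definition fundamental_solution (R : realType) (m1 m2 : nat)
    (v : R -> 'M[R[i]]_(m1, m2)) (u : R -> R[i] -> 'M[R[i]]_(m1 + m2)) : Prop :=
  forall z : R[i], dirac_solution v z (fun x => u x z) /\ u 0 z = 1%:M.

Definition upper_half_plane (R : realType) : set R[i] :=
  [set z | 0 < complex.Im z].

(* R[i]^o is R[i] as a normed module over itself, so derivable is complex
   differentiability. *)
Definition mx_holomorphic (R : realType) (m n : nat) (D : set R[i])
    (phi : R[i] -> 'M[R[i]]_(m, n)) : Prop :=
  forall z, D z -> forall i j,
    derivable (fun w : R[i]^o => phi w i j : R[i]^o) z 1.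

(* The integral of the matrix function is finite when all its entries are
   summable. Only the values of phi on the upper half-plane matter. *)
Definition weyl_function (R : realType) (m1 m2 : nat)
    (v : R -> 'M[R[i]]_(m1, m2)) (phi : R[i] -> 'M[R[i]]_(m2, m1)) : Prop :=
  mx_holomorphic (@upper_half_plane R) phi /\
  exists2 u : R -> R[i] -> 'M[R[i]]_(m1 + m2), fundamental_solution v u &
    forall z, upper_half_plane z ->
      mx_summable `[0, +oo[ (fun x =>
        row_mx 1%:M (adjmx (phi z)) *m adjmx (u x z) *m u x z
          *m col_mx 1%:M (phi z)).

(* Main.v *)
(* Only spectral parameters z = i eta on the imaginary axis are used.  Let
   N(x, eta) = u(x, z) j uhat(x, z^* )^* (transfer below), so that N(x, .) = j
   for all x amounts to v = vhat.  For fixed x, N(x, .) is the Laplace transform of a measure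
   supported in [-2x, 2x].  If both systems have the Weyl function phi, then
   Weyl solutions decay like exp(- |eta| x), and
   [I; phi] [I, 0] - [0; I] [phi, I] = j writes N(x, .) as a sum of products of
   decaying and growing solutions, hence N(x, .) is bounded on the whole line.
   Boundedness at +oo and at -oo confines the measure to the origin, so
   N(x, .) is constant.  Comparing the x-derivatives at eta = 0 and eta = 1
   gives j N = N j almost everywhere; then dN/dx = 0, N = j and v = vhat.

   Measures and integrals are avoided.  A Laplace transform is described by the
   bound it yields on finite combinations of its values against the sup norm of
   the matching combinations of exponentials.  Gronwall-type estimates rest on
   the fact that v is controlled by the derivative of the absolutely continuous
   function u(., 0), and are iterated over short intervals. *)
Require Import Defs.
From HB Require Import structures.
From mathcomp Require Import all_boot all_order all_algebra.
From mathcomp Require Import all_classical all_reals all_analysis.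
From mathcomp Require Import complex measurable_realfun ring lra.

Import Order.TTheory GRing.Theory Num.Theory.
Import numFieldNormedType.Exports.
Local Open Scope classical_set_scope.
Local Open Scope ring_scope.

Set Implicit Arguments.
Unset Strict Implicit.

(** * Increments of absolutely continuous functions *)

(** On the imaginary axis the diagonal part of the system is real: upper components carry the rate
    [- eta], lower ones the rate [eta]. The decay of Weyl solutions needs no asymptotics of [phi].
    Square-summability forces the upper block to dominate the lower one at every x, and a dominating
    block obeys a Gronwall inequality whose constant depends on the potential and on x only. Since
    the upper block of [I; phi] is I, the size of [phi] never enters. At the conjugate parameter no
    summability is given; there the columns [phi^*; I] are j-orthogonal to the Weyl columns, and
    this duality yields the opposite domination. Decaying and growing factors have reciprocal rates,
    so their products are bounded uniformly in eta > 0. For eta < 0 one takes adjoints, which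
    exchanges the two systems. *)

#[global] Instance ae_leb_filter (R : realType) : Filter (almost_everywhere (leb R)).
Proof. exact: (@ae_filter_ringOfSetsType _ _ R (@completed_lebesgue_measure R)). Qed.

Section intervals.
Variable R : realType.
Implicit Types (a b c x s t : R) (F G : seq (R * R)).

(** Finite families of nonoverlapping intervals are kept as lists ordered from left to right, gaps
    allowed, so that families on adjacent intervals merge by concatenation. *)
Fixpoint chain a F b : bool :=
  if F is i :: F' then [&& a <= i.1, i.1 <= i.2 & chain i.2 F' b] else a <= b.

Lemma chain_le a F b : chain a F b -> a <= b.
Proof.
elim: F a => //= -[c d] F ih a /= /and3P[ac cd /ih]; lra.
Qed.

Lemma chain_cat a F c G b : chain a F c -> chain c G b -> chain a (F ++ G) b.
Proof.
elim: F a => [a /= ac|[d e] F ih a /= /and3P[-> -> /ih h] /h //].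
by case: G => [|[d e] G] /=; [exact: le_trans | move=> /and3P[h -> ->]; rewrite (le_trans
  ac h)].
Qed.

Lemma chain_bound a F b i : chain a F b -> i \in F ->
  [/\ a <= i.1, i.1 <= i.2 & i.2 <= b].
Proof.
elim: F a => //= j F ih a /and3P[aj jj h]; rewrite inE => /predU1P[->|iF].
  by split => //; exact: chain_le h.
by have [h1 h2 h3] := ih _ h iF; split => //; lra.
Qed.

Lemma chain_nth a F b (i j : nat) : chain a F b -> (i < j < size F)%N ->
  (nth (0, 0) F i).2 <= (nth (0, 0) F j).1.
Proof.
elim: F a i j => [a i j _|k F ih a [|i] [|j] //= /and3P[ak kk h]].
- by rewrite ltn0 andbF.
- by move=> jF; have [] := chain_bound h (mem_nth (0, 0) jF).
- by move=> ij; apply: (ih _ _ _ h).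
Qed.

Lemma ac_chain a b (f : R -> R) : abs_continuous a b f ->
  forall e : R, 0 < e -> exists2 d : R, 0 < d & forall F, chain a F b ->
    \sum_(i <- F) (i.2 - i.1) < d -> \sum_(i <- F) `|f i.2 - f i.1| < e.
Proof.
move=> acf e e0; have [d d0 h] := acf e e0; exists d => // F cF.
rewrite !(big_nth (0, 0)) !big_mkord => Fd.
apply: (h (size F) (fun k => (nth (0, 0) F k).1) (fun k => (nth (0, 0) F k).2)) => //.
  by move=> k; have [] := chain_bound cF (mem_nth (0, 0) (ltn_ord k)).
apply/trivIsetP => /= i j _ _ ij.
wlog lt : i j ij / (i < j)%N.
  move=> hw; have [lt|lt|e'] := ltngtP i j; first exact: hw.
    by rewrite setIC; apply: hw => //; rewrite eq_sym.
  by move/eqP: ij; case; apply/val_inj.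
apply/seteqP; split => // x /= []; rewrite !in_itv /= => /andP[_ h1] /andP[h2 _].
have := @chain_nth a F b i j cF; rewrite lt ltn_ord => /(_ isT); lra.
Qed.

(** Compactness of [[a, b]] in the form of Cousin's lemma: an interval around the supremum of the
    points reachable from [a] either reaches [b] or goes past that supremum. *)
Lemma cousin (P : R -> R -> Prop) a b : a <= b ->
  (forall s m t, P s m -> P m t -> P s t) ->
  (forall x, a <= x <= b -> exists2 d : R, 0 < d &
     forall s t, a <= s -> t <= b -> s <= x <= t -> t - s < d -> P s t) ->
  P a b.
Proof.
move=> ab Padd loc.
pose E := [set x | a <= x <= b /\ P a x].
have Ea : E a.
  split; first by rewrite lexx.
  have [|d d0 h] := loc a; first by rewrite lexx.
  by apply: h; rewrite ?lexx ?subrr.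
have ubE : ubound E b by move=> x [/andP[]].
have hs : has_sup E by split; [exists a | exists b].
have ca : a <= sup E by apply: ub_le_sup => //; exists b.
have cb : sup E <= b by apply: sup_le_ub => //; exists a.
have [|d d0 h] := loc (sup E); first by rewrite ca cb.
have d2 : 0 < d / 2 by lra.
have [x [/andP[ax xb] Pax] hx] := sup_adherent d2 hs.
have xc : x <= sup E by apply: ub_le_sup => //; [exists b | split; rewrite ?ax].
have [hb|hb] := leP b (sup E + d / 4).
  by apply: (Padd _ x) => //; apply: h => //; lra.
have : E (sup E + d / 4).
  split; first lra.
  by apply: (Padd _ x) => //; apply: h => //; lra.
by move=> /(ub_le_sup hs.2); lra.
Qed.

Local Notation mu := (@lebesgue_measure R).

Lemma chain_measure_le (U : set R) a F b : measurable (U : set (measurableTypeR R)) ->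
  chain a F b -> (forall i, i \in F -> `]i.1, i.2[ `<=` U) ->
  ((\sum_(i <- F) (i.2 - i.1))%:E <= mu (U `&` `]a, b[%classic))%E.
Proof.
move=> mU; elim: F a => [|[c d] F ih] a; first by rewrite big_nil measure_ge0.
rewrite /= => /and3P[ac cd h] hU; rewrite big_cons EFinD /=.
have db := chain_le h.
apply: (@le_trans _ _ (mu `]c, d[%classic + mu (U `&` `]d, b[%classic))%E).
  apply: leeD.
    rewrite lebesgue_measure_itv /= lte_fin; case: ltP => // dc; rewrite ?lee_fin; last by lra. 
  by apply: ih => // i iF; apply: hU; rewrite inE iF orbT.
rewrite -measureU //=.
- apply: le_measure; rewrite ?inE.
  + by apply: measurableU => //; apply: measurableI.
  + by apply: measurableI.
  + move=> x [xcd|[Ux xdb]].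
      split; first by apply: (hU (c, d)) => //; rewrite inE eqxx.
      by move: xcd; rewrite /= !in_itv /=; lra.
    by split => //; move: xdb; rewrite /= !in_itv /=; lra.
- exact: measurableI.
- apply/seteqP; split => // x [] /=; rewrite !in_itv /= => xcd [_]; lra.
Qed.

(** Outer regularity of Lebesgue measure. The bound on chains is the only trace of the smallness of
    [U] that later arguments see. *)
Lemma null_open_cover (N : set R) : (leb R).-negligible N ->
  forall e : R, 0 < e -> exists U : set R, [/\ open U, N `<=` U &
    forall a F b, chain a F b -> (forall i, i \in F -> `]i.1, i.2[ `<=` U) ->
      \sum_(i <- F) (i.2 - i.1) <= e].
Proof.
move=> [A [mA A0 NA]] e e0.
have [U [oU AU hU]] := outer_measure_open_le A e0.
exists U; split => //; first exact: subset_trans AU.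
move=> a F b cF FU; rewrite -lee_fin.
have mU : measurable (U : set (measurableTypeR R)) by exact: open_measurable.
apply: (le_trans (chain_measure_le mU cF FU)).
apply: (@le_trans _ _ (mu U)).
  by apply: le_measure; rewrite ?inE //; exact: measurableI.
apply: (le_trans hU).
move: A0; rewrite /completed_lebesgue_measure /completed_lebesgue_stieltjes_measure /=.
by rewrite /completed_measure_extension => ->; rewrite add0e.
Qed.


Lemma ae_neq (c : R) : {ae leb R, forall x : R, x != c}.
Proof.
exists [set c]; split.
- apply: sub_caratheodory; exact: (@measurable_set1 R c).
- exact: (@lebesgue_measure_set1 R c).
- by move=> x /= /negP; rewrite negbK => /eqP.
Qed.

(** Intervals around [x], rather than starting at it, are what [cousin] supplies; the estimate
    follows by splitting at [x]. *)
Lemma is_derive_straddle (g : R -> R) (x d : R) : is_derive x (1 : R) g d ->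
  forall e : R, 0 < e -> exists2 r : R, 0 < r &
    forall s t, s <= x <= t -> t - s < r ->
      `|g t - g s - d * (t - s)| <= e * (t - s).
Proof.
move=> [gx gd] e e0.
have : (fun h : R => h^-1 *: (g (h + x) - g x)) @ 0^' --> d.
  move: gx; rewrite /derivable -gd /derive.
  by under eq_fun do rewrite /GRing.scale /= mulr1.
move=> /cvgrPdist_le /(_ e e0); rewrite near_withinE => /nbhs_ballP [r /= r0 hr].
exists r => // s t /andP[sx xt] str.
have key h : `|h| < r -> `|g (h + x) - g x - d * h| <= e * `|h|.
  move=> hr'; have [->|h0] := eqVneq h 0.
    by rewrite add0r subrr mulr0 subr0 !normr0 mulr0.
  have := hr h; rewrite -ball_normE /= sub0r normrN => /(_ hr' h0) hh.
  rewrite (_ : _ - _ = - h * (d - h^-1 *: (g (h + x) - g x))).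
    by rewrite normrM normrN mulrC ler_wpM2r.
  by rewrite /GRing.scale /=; field.
have h1 := key (t - x); have h2 := key (s - x).
rewrite subrK in h1; rewrite subrK in h2.
have {h1}/h1 h1 : `|t - x| < r by rewrite ger0_norm; lra.
have {h2}/h2 h2 : `|s - x| < r by rewrite ler0_norm; lra.
rewrite (ger0_norm (_ : 0 <= t - x)) in h1; last lra.
rewrite (ler0_norm (_ : s - x <= 0)) in h2; last lra.
move: h1 h2; rewrite !ler_norml => /andP[? ?] /andP[? ?].
by apply/andP; split; lra.
Qed.

(* [w] plays the role of a locally integrable density without mentioning
   integrals: the interval function [nu] bounds its indefinite integral. *)
Definition ac_density (l : R) (w : R -> R) : Prop :=
  exists nu : R -> R -> R,
    (forall e : R, 0 < e -> exists2 d : R, 0 < d & forall a b F,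
       0 <= a -> chain a F b -> b <= l -> b - a < d ->
       \sum_(i <- F) nu i.1 i.2 <= e) /\
    {ae leb R, forall x : R, 0 < x < l -> forall e : R, 0 < e ->
       exists2 r : R, 0 < r & forall s t, s <= x <= t -> t - s < r ->
         w x * (t - s) <= nu s t + e * (t - s)}.

Lemma increment_arith (K eps w dp nu D dd : R) : 0 <= K -> 0 < eps -> 0 <= D ->
  dp <= K * w -> dd - dp * D <= eps / 2 * D ->
  w * D <= nu + eps / (2 * (K + 1)) * D -> dd <= K * nu + eps * D.
Proof.
move=> K0 eps0 D0 dpw h1 h2.
have h3 := ler_wpM2r D0 dpw; have h4 := ler_wpM2l K0 h2.
have : K * (eps / (2 * (K + 1)) * D) <= eps / 2 * D.
  rewrite mulrA; apply: ler_wpM2r => //.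
  rewrite mulrA ler_pdivrMr; last lra.
  by have := mulr_ge0 K0 (ltW eps0); lra.
lra.
Qed.

(** This is the fundamental theorem of calculus as an inequality. Around points where both
    derivative estimates hold, the increment of [p] is charged to [nu]; the remaining points lie in
    an open set of small length, where absolute continuity makes the increments small. The length
    [d] depends on [w] and [e] but not on [p] or [K], and the iterations over short intervals rest
    on this uniformity. *)
Lemma small_increment (l : R) (w : R -> R) : ac_density l w ->
  forall e : R, 0 < e -> exists2 d : R, 0 < d & forall a b (p : R -> R) (K : R),
    0 <= a -> a <= b -> b <= l -> b - a < d -> 0 <= K -> abs_continuous a b p ->
    {ae leb R, forall x : R, a < x < b ->
       exists2 dp, is_derive x (1 : R) p dp & dp <= K * w x} ->
    p b - p a <= K * e.
Proof.
move=> [nu [nu_small nu_dom]] e e0; have [d d0 hd] := nu_small e e0.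
exists d => // a b p K a0 ab bl bad K0 acp hp.
apply/ler_addgt0Pr => h h0.
(* [eps * (b - a)] pays for the intervals around good points, the second [eps] for those inside the
   exceptional open set. *)
have [eps eps0 heps] : exists2 eps : R, 0 < eps & eps * (b - a) + eps <= h.
  have ba1 : 0 < b - a + 1 by lra.
  exists (h / (b - a + 1)); first exact: divr_gt0.
  by rewrite -[X in _ + X]mulr1 -mulrDr divfK // gt_eqF.
have [r r0 hr] := ac_chain acp eps0.
have [good [hN hgood]] : exists good : set R, {ae leb R, forall x : R, good x} /\
    forall x, good x -> [/\ x != a, x != b,
    (a < x < b -> exists2 dp, is_derive x (1 : R) p dp & dp <= K * w x) &
    (0 < x < l -> forall e : R, 0 < e ->
       exists2 r : R, 0 < r & forall s t, s <= x <= t -> t - s < r ->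
         w x * (t - s) <= nu s t + e * (t - s))].
  eexists; split; last by move=> x; exact.
  apply: filterS2 (filterI (ae_neq a) (ae_neq b)) (filterI hp nu_dom).
  by move=> x [? ?] [? ?]; split.
clear hp nu_dom nu_small.
have r20 : 0 < r / 2 by exact: divr_gt0.
have [U [oU NU hU]] := null_open_cover hN r20.
have : exists F G, [/\ chain a F b, chain a G b,
    forall i, i \in F -> `]i.1, i.2[ `<=` U &
    p b - p a <= K * (\sum_(i <- G) nu i.1 i.2) + eps * (b - a)
      + \sum_(i <- F) `|p i.2 - p i.1|].
  apply: (@cousin (fun s t => exists F G, [/\ chain s F t, chain s G t,
    forall i, i \in F -> `]i.1, i.2[ `<=` U &
    p t - p s <= K * (\sum_(i <- G) nu i.1 i.2) + eps * (t - s)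
      + \sum_(i <- F) `|p i.2 - p i.1|] : Prop) _ _ ab).
    move=> s m t [F1 [G1 [cF1 cG1 U1 h1]]] [F2 [G2 [cF2 cG2 U2 h2]]].
    exists (F1 ++ F2), (G1 ++ G2); split; [exact: chain_cat cF2| exact: chain_cat cG2| |].
      by move=> i; rewrite mem_cat => /orP[/U1|/U2].
    by rewrite !big_cat /= mulrDr; clear - h1 h2; lra.
  move=> x /andP[ax xb].
  have [gx|ngx] := pselect (good x).
    have [xa xb' h1 h2] := hgood _ gx.
    have {xa xb'} axb : a < x < b by rewrite !lt_neqAle eq_sym xa ax xb' xb.
    have [dp dpx dpw] := h1 axb.
    have e1 : 0 < eps / 2 by exact: divr_gt0.
    have e2 : 0 < eps / (2 * (K + 1)) by apply: divr_gt0 => //; rewrite mulr_gt0 ?ltr_wpDl.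
    have xl : 0 < x < l by clear - axb a0 bl; lra.
    have [r1 r10 hr1] := is_derive_straddle dpx e1.
    have [r2 r20' hr2] := h2 xl _ e2.
    exists (Num.min r1 r2); first by rewrite lt_min r10.
    move=> s t sa tb sxt; rewrite lt_min => /andP[st1 st2].
    have st : s <= t by case/andP: sxt => /le_trans hsx /hsx.
    exists [::], [:: (s, t)]; split => //=; first by rewrite !lexx st.
    rewrite big_nil big_seq1 /=.
    have := hr1 s t sxt st1; rewrite ler_norml => /andP[_ h3].
    have h4 := hr2 s t sxt st2.
    rewrite addr0; apply: increment_arith K0 eps0 _ dpw h3 h4.
    by rewrite subr_ge0.
  have Ux : U x by exact: NU.
  have [r1 r10 hr1] : exists2 r1 : R, 0 < r1 & forall y, `|x - y| < r1 -> U y.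
    move: oU; rewrite openE => /(_ x Ux) /nbhs_ballP [r1 /= r10 h1].
    by exists r1 => // y xy; apply: h1; rewrite -ball_normE.
  exists r1 => // s t sa tb sxt st1.
  have st : s <= t by case/andP: sxt => /le_trans hsx /hsx.
  exists [:: (s, t)], [::]; split => //=; first by rewrite !lexx st.
    move=> i; rewrite inE => /eqP -> y /=; rewrite in_itv /= => syt.
    by apply: hr1; clear - sxt st1 syt; rewrite ltr_norml; lra.
  rewrite big_nil big_seq1 /= mulr0 add0r.
  by apply: (le_trans (ler_norm _)); rewrite lerDr mulr_ge0 ?subr_ge0 // ltW.
move=> [F [G [cF cG FU hFG]]].
have h1 : \sum_(i <- G) nu i.1 i.2 <= e by apply: (hd a b).
have h2 : \sum_(i <- F) `|p i.2 - p i.1| < eps.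
  by apply: hr => //; apply: le_lt_trans (hU _ _ _ cF FU) _; rewrite ltr_pdivrMr //
    mulr_natr mulr2n ltrDl.
by move: (ler_wpM2l K0 h1) hFG h2 heps; clear; lra.
Qed.

End intervals.

(** * Closure properties of absolutely continuous functions *)

Section absolute_continuity.
Variable R : realType.
Implicit Types (a b k x : R) (f g : R -> R).

Lemma ac_sub a b a' b' f : a <= a' -> b' <= b ->
  abs_continuous a b f -> abs_continuous a' b' f.
Proof.
move=> aa bb acf e /acf[d d0 h]; exists d => // n s t st; apply: h => k.
by have [h1 [h2 h3]] := st k; split; [exact: le_trans h1 | split => //; exact: le_trans bb].
Qed.

Lemma ac_lipschitz a b f (L : R) :
  (forall s t, a <= s -> s <= t -> t <= b -> `|f t - f s| <= L * (t - s)) ->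
  abs_continuous a b f.
Proof.
move=> lip e e0; have L1 : 0 < `|L| + 1 by rewrite ltr_wpDl.
exists (e / (`|L| + 1)); first exact: divr_gt0.
move=> n s t st _; rewrite ltr_pdivlMr // => h.
apply: le_lt_trans h; rewrite mulr_suml ler_sum // => k _.
have [h1 [h2 h3]] := st k; apply: (le_trans (lip _ _ h1 h2 h3)).
rewrite mulrC ler_wpM2l ?subr_ge0 // (le_trans (ler_norm _)) //.
by rewrite lerDl.
Qed.

Lemma ac_cst a b k : abs_continuous a b (fun=> k).
Proof. by apply: (@ac_lipschitz _ _ _ 0) => s t _ _ _; rewrite subrr normr0 mul0r. Qed.

Lemma ac_modulus a b f : abs_continuous a b f -> forall e : R, 0 < e ->
  exists2 d : R, 0 < d & forall s t, a <= s -> s <= t -> t <= b -> t - s < d ->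
    `|f t - f s| < e.
Proof.
move=> acf e e0; have [d d0 h] := ac_chain acf e0; exists d => // s t sa st tb tsd.
by have := h [:: (s, t)]; rewrite !big_seq1 /= sa st tb; apply.
Qed.

Lemma ac_bounded a b f : abs_continuous a b f ->
  exists2 K : R, 0 <= K & forall x, a <= x <= b -> `|f x| <= K.
Proof.
move=> acf; have [ab|ba] := leP a b; last by exists 0 => // x; lra.
have [d d0 h] := ac_modulus acf ltr01.
have [K hK] : exists K : R, forall x, a <= x <= b -> `|f x| <= K.
  apply: (@cousin _ (fun s t => exists K : R, forall x, s <= x <= t -> `|f x| <= K) _ _ ab).
    move=> s m t [K1 h1] [K2 h2]; exists (Num.max K1 K2) => x /andP[sx xt].
    rewrite le_max; have [xm|mx] := leP x m; first by rewrite h1 // sx.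
    by rewrite h2 ?orbT // xt ltW.
  move=> x /andP[ax xb]; exists d => // s t sa tb /andP[sx xt] tsd.
  exists (`|f s| + 1) => y /andP[sy yt].
  have : `|f y - f s| < 1.
    by apply: h => //; [exact: le_trans tb | apply: le_lt_trans tsd; rewrite lerD2r].
  by have := ler_normD (f y - f s) (f s); rewrite subrK; clear; lra.
exists (Num.max K 0) => [|x xab]; first by rewrite le_max lexx orbT.
by rewrite le_max hK.
Qed.

Lemma acD a b f g : abs_continuous a b f -> abs_continuous a b g ->
  abs_continuous a b (fun x => f x + g x).
Proof.
move=> acf acg e e0; have e2 : 0 < e / 2 by rewrite divr_gt0.
have [d d0 h] := acf _ e2; have [d' d'0 h'] := acg _ e2.
exists (Num.min d d') => [|n s t st tr]; first by rewrite lt_min d0.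
rewrite lt_min => /andP[hd hd'].
apply: (@le_lt_trans _ _ (\sum_(k < n) (`|f (t k) - f (s k)| + `|g (t k) - g (s k)|))).
  by apply: ler_sum => k _; rewrite opprD addrACA ler_normD.
by rewrite big_split /= (splitr e) ltrD ?h ?h'.
Qed.

Lemma acM a b f g : abs_continuous a b f -> abs_continuous a b g ->
  abs_continuous a b (fun x => f x * g x).
Proof.
move=> acf acg e e0.
have [K1 K10 hK1] := ac_bounded acf; have [K2 K20 hK2] := ac_bounded acg.
pose K := K1 + K2 + 1; have K0 : 0 < K by rewrite ltr_wpDl // addr_ge0.
have e2 : 0 < e / K / 2 by rewrite !divr_gt0.
have [d d0 h] := acf _ e2; have [d' d'0 h'] := acg _ e2.
exists (Num.min d d') => [|n s t st tr]; first by rewrite lt_min d0.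
rewrite lt_min => /andP[hd hd'].
apply: (@le_lt_trans _ _ (\sum_(k < n) (`|f (t k) - f (s k)| + `|g (t k) - g (s k)|) * K)).
  apply: ler_sum => k _; have [h1 [h2 h3]] := st k.
  rewrite (_ : _ - _ = (f (t k) - f (s k)) * g (t k) + f (s k) * (g (t k) - g (s k)));
    last by ring.
  rewrite (le_trans (ler_normD _ _)) // !normrM mulrDl lerD //.
    apply: ler_wpM2l => //; apply: (le_trans (hK2 _ _)); first by rewrite h3 (le_trans h1).
    by rewrite /K -addrA addrCA lerDl addr_ge0.
  rewrite mulrC; apply: ler_wpM2l => //; apply: (le_trans (hK1 _ _)); first by rewrite h1
    (le_trans h2).
  by rewrite /K -addrA lerDl addr_ge0.
rewrite -mulr_suml big_split /= -ltr_pdivlMr // (splitr (e / K)) ltrD ?h ?h' //.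
Qed.

Lemma acN a b f : abs_continuous a b f -> abs_continuous a b (fun x => - f x).
Proof.
move=> acf; rewrite (_ : (fun x => - f x) = fun x => -1 * f x).
  by apply: (@acM a b (fun=> -1)) => //; exact: ac_cst.
by apply/funext => x; rewrite mulN1r.
Qed.

Lemma ac_expR a b k : abs_continuous a b (fun x => expR (k * x)).
Proof.
pose B := `|a| + `|b|.
apply: (@ac_lipschitz _ _ _ (expR (`|k| * B) * `|k|)) => s t sa st tb.
have bnd x : a <= x <= b -> k * x <= `|k| * B.
  move=> xab; apply: (le_trans (ler_norm _)); rewrite normrM ler_wpM2l //.
  have := ler_norm a; have := ler_norm b; have := ler_norm (-a); have := ler_norm (-b).
  have := normr_ge0 a; have := normr_ge0 b.
  by rewrite !normrN /B ler_norml; clear - xab; lra.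
have key (u v : R) : u <= v -> expR v - expR u <= expR v * (v - u).
  move=> uv; have := expR_ge1Dx (u - v); rewrite -(ler_pM2l (expR_gt0 v)).
  by rewrite -expRD (addrC v) subrK; clear; lra.
rewrite -mulrA -[t - s]ger0_norm ?subr_ge0 // -normrM mulrBr.
have main (u v M : R) : u <= v -> v <= M ->
    `|expR v - expR u| <= expR M * `|v - u|.
  move=> uv vB; rewrite !ger0_norm ?subr_ge0 ?ler_expR //.
  by apply: (le_trans (key _ _ uv)); rewrite ler_wpM2r ?subr_ge0 ?ler_expR.
have [st'|ts'] := leP (k * s) (k * t); first by rewrite main // bnd // tb (le_trans sa).
by rewrite distrC (distrC (k * t)) main ?(ltW ts') // bnd // sa (le_trans st).
Qed.

End absolute_continuity.

(** * Complex-valued functions of a real variable *)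

Section complex_valued.
Variable R : realType.
Local Notation C := R[i].
Local Notation Re := (@complex.Re R).
Local Notation Im := (@complex.Im R).
Implicit Types (a b x : R) (z w : C) (f g : R -> C).

Lemma ReD z w : Re (z + w) = Re z + Re w.
Proof. by case: z w => [? ?] []. Qed.
Lemma ImD z w : Im (z + w) = Im z + Im w.
Proof. by case: z w => [? ?] []. Qed.
Lemma ReM z w : Re (z * w) = Re z * Re w - Im z * Im w.
Proof. by case: z w => [? ?] []. Qed.
Lemma ImM z w : Im (z * w) = Re z * Im w + Im z * Re w.
Proof. by case: z w => [? ?] []. Qed.

Definition cac a b f :=
  abs_continuous a b (fun x => Re (f x)) /\ abs_continuous a b (fun x => Im (f x)).

Definition cderive f x z :=
  is_derive x (1 : R) (fun t => Re (f t)) (Re z) /\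
  is_derive x (1 : R) (fun t => Im (f t)) (Im z).

Lemma cac_sub a b a' b' f : a <= a' -> b' <= b -> cac a b f -> cac a' b' f.
Proof. by move=> aa bb [h1 h2]; split; apply: ac_sub aa bb _. Qed.

Lemma cac_cst a b z : cac a b (fun=> z).
Proof. by split; exact: ac_cst. Qed.

Lemma cacD a b f g : cac a b f -> cac a b g -> cac a b (fun x => f x + g x).
Proof.
move=> [f1 f2] [g1 g2]; split.
  by under eq_fun do rewrite ReD; exact: (acD f1 g1).
by under eq_fun do rewrite ImD; exact: (acD f2 g2).
Qed.

Lemma cacM a b f g : cac a b f -> cac a b g -> cac a b (fun x => f x * g x).
Proof.
move=> [f1 f2] [g1 g2]; split.
  by under eq_fun do rewrite ReM; exact: (acD (acM f1 g1) (acN (acM f2 g2))).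
by under eq_fun do rewrite ImM; exact: (acD (acM f1 g2) (acM f2 g1)).
Qed.

Lemma cac_conj a b f : cac a b f -> cac a b (fun x => conjc (f x)).
Proof.
move=> [f1 f2]; split.
  by rewrite (_ : (fun x => _) = (fun x => Re (f x))) //; apply/funext => x; case: (f x).
by rewrite (_ : (fun x => _) = (fun x => - Im (f x))); [exact: acN|apply/funext => x;
  case: (f x)].
Qed.

Lemma cac_real a b (h : R -> R) : abs_continuous a b h -> cac a b (fun x => (h x)%:C%C).
Proof. by move=> ?; split => //=; exact: ac_cst. Qed.

Lemma cac_sum a b (I : Type) (s : seq I) (P : pred I) (F : I -> R -> C) :
  (forall i, cac a b (F i)) -> cac a b (fun x => \sum_(i <- s | P i) F i x).
Proof.
move=> h; elim: s => [|i s ih].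
  by under eq_fun do rewrite big_nil; exact: cac_cst.
under eq_fun do rewrite big_cons.
by case: (P i) => //; exact: (cacD (h i) ih).
Qed.

Lemma cderive_eq f x z w : cderive f x z -> z = w -> cderive f x w.
Proof. by move=> h <-. Qed.

Lemma cderive_cst x z : cderive (fun=> z) x 0.
Proof. by split; exact: is_derive_cst. Qed.

Lemma cderiveD f g x z w : cderive f x z -> cderive g x w ->
  cderive (fun t => f t + g t) x (z + w).
Proof.
move=> [f1 f2] [g1 g2]; split.
  by rewrite ReD; under eq_fun do rewrite ReD; exact: (is_deriveD f1 g1).
by rewrite ImD; under eq_fun do rewrite ImD; exact: (is_deriveD f2 g2).
Qed.

Lemma cderiveM f g x z w : cderive f x z -> cderive g x w ->
  cderive (fun t => f t * g t) x (z * g x + f x * w).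
Proof.
move=> [f1 f2] [g1 g2]; split.
  under eq_fun do rewrite ReM.
  apply: (is_derive_eq (is_deriveB (is_deriveM f1 g1) (is_deriveM f2 g2))).
  by rewrite ReD !ReM /GRing.scale /=; ring.
under eq_fun do rewrite ImM.
apply: (is_derive_eq (is_deriveD (is_deriveM f1 g2) (is_deriveM f2 g1))).
by rewrite ImD !ImM /GRing.scale /=; ring.
Qed.

Lemma cderive_conj f x z : cderive f x z -> cderive (fun t => conjc (f t)) x (conjc z).
Proof.
move=> [f1 f2]; split.
  rewrite (_ : (fun x => _) = (fun x => Re (f x))); first by case: z f1 {f2}.
  by apply/funext => y; case: (f y).
rewrite (_ : (fun x => _) = (fun x => - Im (f x))); last by apply/funext => y; case: (f y).
rewrite (_ : Im _ = - Im z); last by case: z {f1 f2}.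
exact: is_deriveN.
Qed.

Lemma cderive_real (h : R -> R) x (d : R) : is_derive x (1 : R) h d ->
  cderive (fun t => (h t)%:C%C) x d%:C%C.
Proof. by move=> hd; split => //=; exact: is_derive_cst. Qed.

Lemma cderive_sum (I : Type) (s : seq I) (P : pred I) (F : I -> R -> C) (D : I -> C) x :
  (forall i, cderive (F i) x (D i)) ->
  cderive (fun t => \sum_(i <- s | P i) F i t) x (\sum_(i <- s | P i) D i).
Proof.
move=> h; elim: s => [|i s ih].
  by rewrite big_nil; under eq_fun do rewrite big_nil; exact: cderive_cst.
under eq_fun do rewrite big_cons.
by rewrite big_cons; case: (P i) => //; exact: (cderiveD (h i) ih).
Qed.

Lemma is_derive_expRM (k x : R) : is_derive x (1 : R) (fun t => expR (k * t)) (k * expR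
  (k * x)).
Proof.
have h : is_derive x (1 : R) (fun t => k * t) k.
  by apply: (is_derive_eq (is_deriveZ k (is_derive_id x (1 : R)))); rewrite /GRing.scale
    /= mulr1.
apply: (is_derive_eq (is_derive1_comp (is_derive_expR _) h)).
by rewrite mulrC.
Qed.

End complex_valued.

(** * Densities without integrals *)

Section densities.
Variable R : realType.
Local Notation C := R[i].
Local Notation Re := (@complex.Re R).
Local Notation Im := (@complex.Im R).
Local Notation normc := (@Normc.normc R).
Implicit Types (a b l x : R) (w : R -> R) (F : seq (R * R)).

Lemma ger_normc_Re (z : C) : `|Re z| <= normc z.
Proof.
by case: z => x y /=; rewrite -sqrtr_sqr ler_sqrt ?addr_ge0 ?sqr_ge0 // lerDl sqr_ge0.
Qed.

Lemma ger_normc_Im (z : C) : `|Im z| <= normc z.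
Proof.
by case: z => x y /=; rewrite -sqrtr_sqr ler_sqrt ?addr_ge0 ?sqr_ge0 // lerDr sqr_ge0.
Qed.

Lemma normc_ge0 (z : C) : 0 <= normc z.
Proof. by case: z => x y; exact: sqrtr_ge0. Qed.

Lemma normc_real (x : R) : normc x%:C%C = `|x|.
Proof. by rewrite /= expr0n /= addr0 sqrtr_sqr. Qed.

Lemma normc_le_ReIm (z : C) : normc z <= `|Re z| + `|Im z|.
Proof.
rewrite -(@ler_pXn2r _ 2%N) // ?nnegrE ?normc_ge0 ?addr_ge0 //.
case: z => x y /=; rewrite sqr_sqrtr ?addr_ge0 ?sqr_ge0 //.
by have := mulr_ge0 (normr_ge0 x) (normr_ge0 y); rewrite sqrrD !real_normK ?num_real //; lra.
Qed.

Lemma le_normc_sum (I : Type) (s : seq I) (P : pred I) (F : I -> C) :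
  normc (\sum_(i <- s | P i) F i) <= \sum_(i <- s | P i) normc (F i).
Proof.
elim/big_ind2: _ => [|x y z t h1 h2|//]; first by rewrite Normc.normc0.
exact: le_trans (le_normcD _ _) (lerD h1 h2).
Qed.

Lemma chain_length a F b : chain a F b -> \sum_(i <- F) (i.2 - i.1) <= b - a.
Proof.
elim: F a => [|[c d] F ih] a /=; first by rewrite big_nil subr_ge0.
by move=> /and3P[ac cd /ih]; rewrite big_cons /=; lra.
Qed.

Lemma chain_widen a b a' b' F : a' <= a -> b <= b' -> chain a F b -> chain a' F b'.
Proof.
move=> aa bb; elim: F a a' aa => [a a' aa /= ab|[c d] F ih a a' aa /=].
  exact: le_trans aa (le_trans ab bb).
by move=> /and3P[ac -> /ih ->] //; rewrite (le_trans aa ac).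
Qed.

(** The increment [|g t - g s|] serves as [nu], so no indefinite integral of [|dg|] has to be
    formed. *)
Lemma ac_density_derive l (g dg : R -> R) : abs_continuous 0 l g ->
  {ae leb R, forall x : R, 0 < x < l -> is_derive x (1 : R) g (dg x)} ->
  ac_density l (fun x => `|dg x|).
Proof.
move=> acg hg; exists (fun s t => `|g t - g s|); split.
  move=> e e0; have [d d0 h] := ac_chain acg e0; exists d => // a b F a0 cF bl bad.
  by apply/ltW/h; [exact: chain_widen cF | apply: le_lt_trans (chain_length cF) _].
apply: filterS hg => x hx /hx /is_derive_straddle h e /h [r r0 hr]; exists r => // s t sxt tr.
have st : s <= t by case/andP: sxt => /le_trans hsx /hsx.
rewrite -[X in _ * X]ger0_norm ?subr_ge0 // -normrM.
have -> : dg x * (t - s) = (g t - g s) - (g t - g s - dg x * (t - s)) by ring.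
by apply: (le_trans (ler_normB _ _)); rewrite lerD2l hr.
Qed.

Lemma ac_density0 l : ac_density l (fun=> 0).
Proof.
exists (fun _ _ => 0); split=> [e e0|].
  by exists 1 => // a b F _ _ _ _; rewrite big1_eq ltW.
apply: filterE => x _ e e0; exists 1 => // s t /andP[sx xt] _.
by rewrite mul0r add0r mulr_ge0 ?subr_ge0 ?(le_trans sx) // ltW.
Qed.

Lemma ac_densityD l w1 w2 : ac_density l w1 -> ac_density l w2 ->
  ac_density l (fun x => w1 x + w2 x).
Proof.
move=> [n1 [s1 d1]] [n2 [s2 d2]]; exists (fun s t => n1 s t + n2 s t); split.
  move=> e e0; have e2 : 0 < e / 2 by rewrite divr_gt0.
  have [r1 r10 h1] := s1 _ e2; have [r2 r20 h2] := s2 _ e2.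
  exists (Num.min r1 r2) => [|a b F a0 cF bl]; first by rewrite lt_min r10.
  rewrite lt_min big_split /= (splitr e) => /andP[b1 b2].
  by apply: lerD; [exact: (h1 a b) | exact: (h2 a b)].
apply: filterS2 d1 d2 => x h1 h2 xl e e0; have e2 : 0 < e / 2 by rewrite divr_gt0.
have [r1 r10 {}h1] := h1 xl _ e2; have [r2 r20 {}h2] := h2 xl _ e2.
exists (Num.min r1 r2) => [|s t sxt]; first by rewrite lt_min r10.
rewrite lt_min => /andP[/(h1 _ _ sxt) {}h1 /(h2 _ _ sxt) {}h2].
by move: h1 h2; clear; lra.
Qed.

Lemma ac_densityZ l w (K : R) : 0 <= K -> ac_density l w ->
  ac_density l (fun x => K * w x).
Proof.
move=> K0 [nu [s1 d1]]; exists (fun s t => K * nu s t).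
have K1 : 0 < K + 1 by rewrite ltr_wpDl.
have hK e : 0 < e -> K * (e / (K + 1)) <= e.
  move=> e0; rewrite mulrA ler_pdivrMr // mulrC ler_wpM2l ?lerDl ?ltW //.
split.
  move=> e e0; have e2 : 0 < e / (K + 1) by rewrite divr_gt0.
  have [r r0 h] := s1 _ e2; exists r => // a b F a0 cF bl bad.
  rewrite -mulr_sumr (le_trans _ (hK _ e0)) //.
  by apply: ler_wpM2l => //; exact: (h a b).
apply: filterS d1 => x h xl e e0; have e2 : 0 < e / (K + 1) by rewrite divr_gt0.
have [r r0 {}h] := h xl _ e2; exists r => // s t sxt str.
have st : s <= t by case/andP: sxt => /le_trans hsx /hsx.
rewrite -mulrA (le_trans (ler_wpM2l K0 (h _ _ sxt str))) // mulrDr lerD2l mulrA.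
by rewrite ler_wpM2r ?subr_ge0 // hK.
Qed.

Lemma ac_density_sum l (I : Type) (s : seq I) (w : I -> R -> R) :
  (forall i, ac_density l (w i)) -> ac_density l (fun x => \sum_(i <- s) w i x).
Proof.
move=> h; elim: s => [|i s ih].
  by under eq_fun do rewrite big_nil; exact: ac_density0.
by under eq_fun do rewrite big_cons; exact: (ac_densityD (h i) ih).
Qed.

Lemma ac_density_le l w w' : ac_density l w' ->
  {ae leb R, forall x : R, 0 < x < l -> w x <= w' x} -> ac_density l w.
Proof.
move=> [nu [h1 h2]] h3; exists nu; split => //.
apply: filterS2 h2 h3 => x h2 h3 xl e e0; have [r r0 hr] := h2 xl e e0.
exists r => // s t sxt str; apply: le_trans (hr _ _ sxt str).
case/andP: sxt => sx xt.
by apply: ler_wpM2r; [rewrite subr_ge0 (le_trans sx) | exact: h3].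
Qed.

Lemma small_cincrement l w : ac_density l w ->
  forall e : R, 0 < e -> exists2 d : R, 0 < d & forall a b (p : R -> C) (K : R),
    0 <= a -> a <= b -> b <= l -> b - a < d -> 0 <= K -> cac a b p ->
    {ae leb R, forall x : R, a < x < b ->
       exists2 z, cderive p x z & normc z <= K * w x} ->
    normc (p b - p a) <= K * e.
Proof.
move=> hw e e0; have e2 : 0 < e / 2 by rewrite divr_gt0.
have [d d0 hd] := small_increment hw e2; exists d => // a b p K a0 ab bl bad K0 [acR acI] hp.
have absinc (q : R -> R) : abs_continuous a b q ->
    {ae leb R, forall x : R, a < x < b ->
       exists2 z, is_derive x (1 : R) q z & `|z| <= K * w x} -> `|q b - q a| <= K * (e / 2).
  move=> acq hq; rewrite ler_norml; apply/andP; split; last first.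
    apply: hd => //; apply: filterS hq => x h /h [z z1 z2]; exists z => //.
    exact: le_trans (ler_norm _) z2.
  rewrite -lerN2 opprK opprB.
  rewrite -[q a]opprK addrC.
  apply: (hd a b (fun x => - q x) K) => //; first exact: acN.
  apply: filterS hq => x h /h [z z1 z2]; exists (- z); first exact: is_deriveN.
  by apply: le_trans (ler_norm _) _; rewrite normrN.
have h1 : `|Re (p b) - Re (p a)| <= K * (e / 2).
  apply: (absinc (fun x => Re (p x))) => //; apply: filterS hp => x h /h [z [zR zI] hz].
  by exists (Re z) => //; exact: le_trans (ger_normc_Re z) hz.
have h2 : `|Im (p b) - Im (p a)| <= K * (e / 2).
  apply: (absinc (fun x => Im (p x))) => //; apply: filterS hp => x h /h [z [zR zI] hz].
  by exists (Im z) => //; exact: le_trans (ger_normc_Im z) hz.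
apply: (le_trans (normc_le_ReIm _)); rewrite (splitr e) mulrDr.
by move: h1 h2; case: (p a) => ? ?; case: (p b) => ? ? /= h1 h2; exact: lerD.
Qed.

(** Applied to the supremum S of [h], the step gives S <= B + S / 2. The crude bound [M] only makes
    S finite and then disappears. This is how an unknown is absorbed on a short interval. *)
Lemma halving (T : Type) (P : T -> Prop) (h : T -> R) (B M : R) :
  (forall t, 0 <= h t) -> (forall t, P t -> h t <= M) ->
  (forall S, 0 <= S -> (forall t, P t -> h t <= S) -> forall t, P t -> h t <= B + S / 2) ->
  forall t, P t -> h t <= 2 * B.
Proof.
move=> h0 hM step t Pt; pose E := [set h u | u in P].
have hs : has_sup E by split; [exists (h t), t | exists M => _ [u Pu <-]; exact: hM].
have leS u : P u -> h u <= sup E by move=> Pu; apply: ub_le_sup; [exact: hs.2 | exists u].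
have S0 : 0 <= sup E := le_trans (h0 t) (leS t Pt).
have : sup E <= B + sup E / 2.
  by apply: sup_le_ub => [|_ [u Pu <-]]; [exact: hs.1 | exact: step].
have := leS t Pt; lra.
Qed.

Lemma nat_cover (l d : R) : 0 < d -> exists n : nat, l <= n%:R * d.
Proof.
move=> d0; exists (Num.bound `|l / d|).
rewrite -ler_pdivrMr // (le_trans (ler_norm _)) // ltW //.
exact: archi_boundP.
Qed.

(** Where [w] has mass at most 1/2, [p] at most doubles; [K] is therefore a power of 2 counting the
    steps of length [d / 2] that cover [[0, l]], and is the same for all [p]. *)
Lemma gronwall l w : ac_density l w -> (forall x, 0 <= w x) ->
  exists2 K : R, 0 <= K & forall p : R -> R, abs_continuous 0 l p ->
    (forall x, 0 <= p x) ->
    {ae leb R, forall x : R, 0 < x < l ->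
       exists2 dp, is_derive x (1 : R) p dp & dp <= w x * p x} ->
    forall x, 0 <= x <= l -> p x <= K * p 0.
Proof.
move=> hw w0; have e0 : (0 : R) < 1 / 2 by rewrite divr_gt0.
have [d d0 hd] := small_increment hw e0.
have d20 : 0 < d / 2 by rewrite divr_gt0.
have [n hn] := nat_cover l d20.
exists (2 ^+ n); first by rewrite exprn_ge0.
move=> p acp p0 hp x /andP[x0 xl].
have {hn} : x <= n%:R * (d / 2) by exact: le_trans hn.
elim: n x x0 xl => [x x0 xl|n ih x x0 xl xn].
  by rewrite mul0r expr0 mul1r => xle; rewrite (_ : x = 0) //; apply/eqP; rewrite eq_le xle.
have n0 : 0 <= n%:R * (d / 2) by rewrite mulr_ge0 // ltW.
have [xle|xgt] := leP x (n%:R * (d / 2)).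
  by apply: (le_trans (ih x x0 xl xle)); rewrite ler_wpM2r // exprS ler_peMl ?exprn_ge0
    // ler1n.
set a := n%:R * (d / 2) in n0 xgt *.
have al : a <= l by exact: le_trans (ltW xgt) xl.
have ha : p a <= 2 ^+ n * p 0 by apply: ih.
have [M M0 hM] := ac_bounded acp.
rewrite exprS -mulrA (le_trans _ (_ : 2 * p a <= _)) ?ler_pM2l //.
apply: (@halving _ (fun t => a <= t <= x) p (p a) M) => //; last by rewrite (ltW xgt) lexx.
  move=> t /andP[ta tx]; apply: (le_trans (ler_norm _)); apply: hM.
  by rewrite (le_trans n0 ta) (le_trans tx xl).
move=> S S0 hS t /andP[ta tx]; rewrite -lerBlDl -[S / 2]/(S * 2^-1) -[2^-1]mul1r.
apply: hd => //.
- exact: le_trans tx xl.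
- move: xn tx; rewrite -natr1 mulrDl mul1r -/a; move: d0; clear; lra.
- by apply: ac_sub acp => //; exact: le_trans tx xl.
apply: filterS hp => y hy /andP[ay yt]; have [|dp h1 h2] := hy.
  by rewrite (le_lt_trans n0 ay) (lt_le_trans yt (le_trans tx xl)).
exists dp => //; apply: (le_trans h2); rewrite mulrC ler_wpM2r // hS //.
by rewrite (ltW ay) (le_trans (ltW yt) tx).
Qed.

End densities.

(** * Laplace transforms in dual form *)

Section exponential_duality.
Variable R : realType.
Local Notation C := R[i].
Local Notation normc := (@Normc.normc R).

Lemma cac_bounded (a b : R) (f : R -> C) : cac a b f ->
  exists K : R, forall x, a <= x <= b -> normc (f x) <= K.
Proof.
move=> [/ac_bounded[K1 _ h1] /ac_bounded[K2 _ h2]]; exists (K1 + K2) => x xab.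
by apply: (le_trans (normc_le_ReIm _)); rewrite lerD ?h1 ?h2.
Qed.

Lemma cac_expRM (a b k : R) (f : R -> C) : cac a b f ->
  cac a b (fun x => (expR (k * x))%:C%C * f x).
Proof. by move=> hf; apply: cacM => //; apply: cac_real; exact: ac_expR. Qed.

(** Weighting with [expR (- (eta k * sg))] turns multiplication by [- eta k] into a derivative in
    [sg], so the combinations [Phi al x sg] solve a transport system with speeds at most [L],
    coupled through [w]. By finite propagation the value at [(l, 0)] depends only on the data at x =
    0 with [|sg| <= L * l]. The hypothesis on [r] says that the coupling acts on every combination
    as on a single solution. [K] bounds the total variation of the representing measure, hence must
    not depend on [c], [eta] or [I]. *)
Lemma exp_dual_bound (l : R) (w : R -> R) : 0 <= l -> ac_density l w ->
  forall (A : finType) (lam : A -> R) (L : R), (forall al, `|lam al| <= L) ->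
  exists2 K : R, 0 <= K &
  forall (I : finType) (c eta : I -> R) (f : I -> A -> R -> C),
    (forall k al, cac 0 l (f k al)) ->
    {ae leb R, forall x : R, 0 < x < l -> exists2 r : I -> A -> C,
      forall k al, cderive (f k al) x (- (eta k * lam al)%:C%C * f k al x + r k al) &
      forall (c' : I -> R) (S : R),
        (forall be, normc (\sum_k (c' k)%:C%C * f k be x) <= S) ->
        forall al, normc (\sum_k (c' k)%:C%C * r k al) <= w x * S} ->
  forall B : R,
    (forall al sg, `|sg| <= L * l ->
       normc (\sum_k (c k * expR (- (eta k * sg)))%:C%C * f k al 0) <= B) ->
    forall al, normc (\sum_k (c k)%:C%C * f k al l) <= K * B.
Proof.
move=> l0 hw A lam L hL; have e0 : (0 : R) < 1 / 2 by rewrite divr_gt0.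
have [d d0 hd] := small_cincrement hw e0.
have d20 : 0 < d / 2 by rewrite divr_gt0.
have [n hn] := nat_cover l d20.
exists (2 ^+ n); first by rewrite exprn_ge0.
move=> I c eta f acf hf B hB.
pose Phi al x sg := \sum_k (c k * expR (- (eta k * sg)))%:C%C * f k al x.
have /choice [Kf hKf] : forall ka : I * A, exists K : R, forall x, 0 <= x <= l ->
    normc (f ka.1 ka.2 x) <= K by move=> [k al]; exact: cac_bounded.
have step a b B' : 0 <= a -> a <= b -> b <= l -> b - a < d ->
    (forall al sg, `|sg| <= L * (l - a) -> normc (Phi al a sg) <= B') ->
    forall al x sg, a <= x <= b -> `|sg| <= L * (l - x) ->
      normc (Phi al x sg) <= 2 * B'.
  move=> a0 ab bl bad hB' al x sg xab hsg.
  (* [P] is the slice over [[a, b]] of the cone of dependence of [(l, 0)]; a characteristic followed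
     backwards from one of its points stays in the cone. [M] only has to be finite, as required by
     [halving]. *)
  pose P (t : A * R * R) := a <= t.1.2 <= b /\ `|t.2| <= L * (l - t.1.2).
  pose M := \sum_al \sum_k (`|c k| * expR (`|eta k| * (L * l)) * Kf (k, al)).
  apply: (@halving _ _ P (fun t => normc (Phi t.1.1 t.1.2 t.2)) B' M _ _ _ (al, x, sg)) => //.
  - by move=> t; exact: normc_ge0.
  - move=> [[be y] tau] [/= /andP[ay yb] htau].
    have L0 : 0 <= L := le_trans (normr_ge0 _) (hL be).
    have hM : \sum_k (`|c k| * expR (`|eta k| * (L * l)) * Kf (k, be)) <= M.
      rewrite /M (bigD1 be) //= lerDl sumr_ge0 // => al' _; rewrite sumr_ge0 // => k _.
      rewrite !mulr_ge0 ?expR_ge0 //; apply: le_trans (normc_ge0 _) (hKf (k, al') 0 _).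
      by rewrite lexx.
    apply: (le_trans _ hM); apply: (le_trans (le_normc_sum _ _ _)); apply: ler_sum => k _.
    rewrite Normc.normcM normc_real normrM.
    rewrite (ger0_norm (expR_ge0 _)) ler_pM ?mulr_ge0 ?expR_ge0 ?normc_ge0 //.
      rewrite ler_wpM2l // ler_expR (le_trans (ler_norm _)) // normrN normrM ler_wpM2l //.
      by rewrite (le_trans htau) // ler_wpM2l // gerBl (le_trans a0).
    by apply: (hKf (k, be)); rewrite (le_trans a0 ay) (le_trans yb bl).
  move=> S S0 hS [[be y] tau] [/= /andP[ay yb] htau].
  have L0 : 0 <= L := le_trans (normr_ge0 _) (hL be).
  (* along the characteristic s |-> tau + lam (y - s) the diagonal part of
     the system cancels *)
  pose p s := Phi be s (tau + lam be * (y - s)).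
  have pa : normc (p a) <= B'.
    apply: hB'; rewrite (le_trans (ler_normD _ _)) //.
    rewrite (_ : l - a = (l - y) + (y - a)); last by rewrite addrA subrK.
    by rewrite (mulrDr L) lerD // normrM (ger0_norm (_ : 0 <= y - a)) ?subr_ge0 //
      ler_wpM2r // subr_ge0.
  have -> : Phi be y tau = p y by rewrite /p subrr mulr0 addr0.
  suff hp : normc (p y - p a) <= S * (1 / 2).
    have := le_normcD (p y - p a) (p a); rewrite subrK.
    by move: hp pa; clear; lra.
  have pE : p = fun s => \sum_k (c k * expR (- (eta k * (tau + lam be * y))))%:C%C *
      ((expR (eta k * lam be * s))%:C%C * f k be s).
    apply/funext => s; apply: eq_bigr => k _.
    rewrite [RHS]mulrA -rmorphM /= -(mulrA (c k)) -expRD; congr (_%:C%C * _); congr (_ *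
      expR _); ring.
  apply: hd => //.
  - exact: le_trans yb bl.
  - by apply: le_lt_trans bad; rewrite lerD2r.
  - rewrite pE; apply: cac_sum => k; apply: cacM; first exact: cac_cst.
    by apply: cac_expRM; apply: cac_sub (acf k be) => //; exact: le_trans yb bl.
  apply: filterS hf => s hs /andP[as' sy].
  have sl : s < l by rewrite (lt_le_trans sy) // (le_trans yb).
  have [|r hr hrS] := hs; first by rewrite (le_lt_trans a0 as') sl.
  pose c' k := c k * expR (- (eta k * (tau + lam be * (y - s)))).
  exists (\sum_k (c' k)%:C%C * r k be).
    rewrite pE; apply: cderive_eq.
      apply: cderive_sum => k; apply: cderiveM; first exact: cderive_cst.
      apply: cderiveM; last exact: hr.
      by apply: cderive_real; exact: is_derive_expRM.
    apply: eq_bigr => k _; rewrite mul0r add0r.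
    rewrite (_ : c' k = (c k * expR (- (eta k * (tau + lam be * y)))) * expR (eta k * lam
      be * s)).
      by rewrite !rmorphM /=; ring.
    rewrite /c' -mulrA -expRD; congr (_ * expR _); ring.
  rewrite mulrC; apply: hrS => ga.
  apply: (hS (ga, s, tau + lam be * (y - s))); split => /=.
    by rewrite (ltW as') (le_trans (ltW sy) yb).
  rewrite (le_trans (ler_normD _ _)) //.
  rewrite (_ : l - s = (l - y) + (y - s)); last by rewrite addrA subrK.
  by rewrite (mulrDr L) lerD // normrM (ger0_norm (_ : 0 <= y - s)) ?subr_ge0 ?(ltW sy)
    // ler_wpM2r // subr_ge0 ltW.
have iter (m : nat) x : 0 <= x -> x <= l -> x <= m%:R * (d / 2) ->
    forall al sg, `|sg| <= L * (l - x) -> normc (Phi al x sg) <= 2 ^+ m * B.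
  elim: m x => [|m ih] x x0 xl.
    rewrite mul0r expr0 mul1r => xle al sg.
    have -> : x = 0 by apply/eqP; rewrite eq_le xle.
    by rewrite subr0; exact: hB.
  have m0 : 0 <= m%:R * (d / 2) by rewrite mulr_ge0 // ltW.
  rewrite -natr1 mulrDl mul1r.
  have [xle _ al sg hsg|xgt xn al sg] := leP x (m%:R * (d / 2)).
    apply: (le_trans (ih x x0 xl xle al sg hsg)).
    have B0 : 0 <= 2 ^+ m * B by apply: le_trans (normc_ge0 _) (ih x x0 xl xle al sg hsg).
    by rewrite exprS -mulrA ler_peMl // ler1n.
  rewrite exprS -mulrA; apply: (step (m%:R * (d / 2)) x) => //.
  - exact: ltW.
  - by move: xn d0; clear; lra.
  - by move=> al' sg' h; apply: ih => //; exact: le_trans (ltW xgt) xl.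
  - by rewrite (ltW xgt) lexx.
move=> al; have := iter n l l0 (lexx l) hn al 0.
rewrite normr0 subrr mulr0 lexx => /(_ isT).
by rewrite /Phi; under eq_bigr do rewrite mulr0 oppr0 expR0 mulr1.
Qed.

End exponential_duality.

(** * Exponential cutoffs and bounded Laplace transforms *)

Section exponential_duality_constant.
Variable R : realType.
Local Notation C := R[i].
Local Notation normc := (@Normc.normc R).

Lemma expR_ge1 (x : R) : 0 <= x -> 1 <= expR x.
Proof. by rewrite -expR0 ler_expR. Qed.

Lemma bernoulli (y : R) (N : nat) : 0 <= y <= 1 -> 1 - N%:R * y <= (1 - y) ^+ N.
Proof.
move=> /andP[y0 y1]; elim: N => [|N ih]; first by rewrite mul0r subr0 expr0.
have y1' : 0 <= 1 - y by rewrite subr_ge0.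
rewrite exprS (le_trans _ (ler_wpM2l y1' ih)) // -natr1.
have : 0 <= (N%:R : R) * y * y by rewrite !mulr_ge0.
by clear; lra.
Qed.

Lemma expr1B_le_expR (y : R) (N : nat) : 0 <= y <= 1 -> (1 - y) ^+ N <= expR (- (N%:R * y)).
Proof.
move=> /andP[y0 y1]; rewrite -mulrN expRM_natl.
by rewrite lerXn2r ?nnegrE ?expR_ge0 ?subr_ge0 // expR_ge1Dx.
Qed.

Lemma expRB1_le (q : R) : 0 <= q <= 1 / 2 -> expR q - 1 <= 2 * q.
Proof.
move=> /andP[q0 q1]; have := expR_ge1Dx (- q); rewrite -(ler_pM2l (expR_gt0 q)).
rewrite -expRD subrr expR0; have := expR_gt0 q; nra.
Qed.

Lemma norm_expRB1_le (y : R) : `|y| <= 1 / 2 -> `|expR y - 1| <= 2 * `|y|.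
Proof.
have [y0|y0] := leP 0 y => y1.
  rewrite ger0_norm ?subr_ge0 ?expR_ge1 //.
  by rewrite (ger0_norm y0) expRB1_le // y0 -[X in X <= _]ger0_norm.
rewrite ler0_norm ?subr_le0; last by rewrite -expR0 ler_expR ltW.
have := expR_ge1Dx y; move: y1; rewrite ltr0_norm //; move: y0; clear; lra.
Qed.

(* [cutoff q nu N] approximates the indicator function of the half-line
   [t > 0], shifted to the left by the amount s such that [expR (- (nu * s)) = q]. *)
Definition cutoff (q nu : R) (N : nat) (t : R) : R :=
  (1 - q / N%:R * expR (- (nu * t))) ^+ N.

Definition cutoff_coef (q : R) (N k : nat) : R := 'C(N, k)%:R * (- (q / N%:R)) ^+ k.

(** The term of index 0 of the binomial expansion is the constant 1; the rest is an exponential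
    polynomial with frequencies [nu * k%:R]. *)
Lemma cutoffE q nu N t :
  cutoff q nu N t - 1 =
  \sum_(k <- iota 1 N) cutoff_coef q N k * expR (- (nu * k%:R * t)).
Proof.
rewrite /cutoff exprDn big_ord_recl /= bin0 expr1n mul1r expr0 mulr1n addrC addKr.
rewrite -[iota 1 N]/(iota (1 + 0) N) iotaDl big_map.
rewrite -[N in iota _ N]subn0 -/(index_iota 0 N) big_mkord; apply: eq_bigr => k _.
rewrite /bump /= expr1n mul1r -mulNr exprMn -mulr_natl mulrA; congr (_ * _).
by rewrite -expRM_natl; congr expR; ring.
Qed.

(** Replacing [q] by [- q] makes all coefficients nonnegative, so their absolute values sum to
    [(1 + q / N%:R) ^+ N - 1], which is at most [expR q - 1]. *)
Lemma cutoff_coef_le q N : 0 <= q <= 1 / 2 ->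
  \sum_(k <- iota 1 N) `|cutoff_coef q N k| <= 2 * q.
Proof.
move=> q01; have /andP[q0 _] := q01; apply: le_trans (expRB1_le q01).
have [->|N0] := eqVneq N 0%N; first by rewrite big_nil subr_ge0 expR_ge1.
have -> : \sum_(k <- iota 1 N) `|cutoff_coef q N k| = cutoff (- q) 0 N 0 - 1.
  rewrite cutoffE; apply: eq_bigr => k _; rewrite !mul0r oppr0 expR0 mulr1.
  rewrite /cutoff_coef normrM normrX normrN ger0_norm // ger0_norm ?divr_ge0 //.
  by rewrite mulNr opprK.
rewrite lerB // /cutoff mul0r oppr0 expR0 mulr1 mulNr opprK.
apply: (@le_trans _ _ (expR (q / N%:R) ^+ N)).
  by rewrite lerXn2r ?nnegrE ?expR_ge0 ?addr_ge0 ?divr_ge0 // expR_ge1Dx.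
by rewrite -expRM_natl mulrC divfK // pnatr_eq0.
Qed.

(** As [N] grows the cutoff tends to the double exponential on the right. Bernoulli's inequality and
    [1 - y <= expR (- y)] bracket it as soon as [N] keeps the base in [0, 1]. *)
Lemma cutoff_bounds q nu N t : (0 < N)%N -> 0 <= q -> q * expR (- (nu * t)) <= N%:R ->
  1 - q * expR (- (nu * t)) <= cutoff q nu N t <= expR (- (q * expR (- (nu * t)))) /\
  0 <= cutoff q nu N t <= 1.
Proof.
move=> N0 q0 hN; have N0' : (0 : R) < N%:R by rewrite ltr0n.
have E0 := expR_ge0 (- (nu * t)).
have y01 : 0 <= q / N%:R * expR (- (nu * t)) <= 1.
  by rewrite (mulr_ge0 (divr_ge0 q0 (ltW N0')) E0) /= mulrAC ler_pdivrMr // mul1r.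
have NE : N%:R * (q / N%:R * expR (- (nu * t))) = q * expR (- (nu * t)).
  by field; rewrite gt_eqF.
split; first by rewrite -NE /cutoff bernoulli // expr1B_le_expR.
by case/andP: y01 => y0 y1; rewrite /cutoff exprn_ge0 ?subr_ge0 // exprn_ile1 ?subr_ge0
  // gerBl.
Qed.

(* A function represented by a measure on [-a, a] through the Laplace
   transform, and bounded on the line, comes from a multiple of the Dirac mass
   at 0; the representation is used in its dual form [dual]. *)
Lemma exp_dual_const (F : R -> C) (a K M : R) : 0 <= K ->
  (forall (s : seq (R * R)) (B : R),
    (forall sg, `|sg| <= a -> `|\sum_(p <- s) p.1 * expR (- (p.2 * sg))| <= B) ->
    normc (\sum_(p <- s) (p.1)%:C%C * F p.2) <= K * B) ->
  (forall eta, normc (F eta) <= M) -> F 1 = F 0.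
Proof.
move=> K0 dual bndF.
(* The test function below is at most [4 * q] near the origin and [expR a * q] elsewhere; the
   additional values of [F] contribute [8 * M * q]. *)
pose Z := K * (4 + expR a) + 8 * M.
have M0 : 0 <= M := le_trans (normc_ge0 _) (bndF 0).
have Z0 : 0 <= Z by rewrite /Z addr_ge0 ?mulr_ge0 ?addr_ge0 ?expR_ge0.
(* For negative [a] no [sg] is admissible, so [dual] applies with [B = 0]. *)
have [a0|a0] := leP 0 a; last first.
  have := dual [:: (1, 1); (-1, 0)] 0; rewrite mulr0.
  rewrite !big_cons big_nil /= addr0 !mul1r => h; have {h}h := h _.
  apply/eqP; rewrite -subr_eq0; apply/eqP/Normc.eq0_normc/eqP.
  rewrite eq_le normc_ge0 andbT.
  rewrite (_ : F 1 - F 0 = F 1 + (-1)%:C%C * F 0); last by rewrite rmorphN1 mulN1r.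
  by apply: h => sg hs; have := le_lt_trans (le_trans (normr_ge0 _) hs) a0; rewrite ltxx.
suff main q : 0 < q -> q <= 1 / 4 -> normc (F 1 - F 0) <= q * Z.
  apply/eqP; rewrite -subr_eq0; apply/eqP/Normc.eq0_normc/eqP.
  rewrite eq_le normc_ge0 andbT; apply/ler_addgt0Pr => e e0; rewrite add0r.
  pose q := Num.min (1 / 4) (e / (Z + 1)).
  have Z1 : 0 < Z + 1 by rewrite ltr_wpDl.
  have q0 : 0 < q by rewrite lt_min !divr_gt0.
  apply: (le_trans (main q q0 _)); first by rewrite ge_min lexx.
  apply: (@le_trans _ _ (e / (Z + 1) * (Z + 1))); last by rewrite divfK // gt_eqF.
  by rewrite ler_pM ?(ltW q0) // ?lerDl // ge_min lexx orbT.
move=> q0 q4.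
have q12 : 0 <= q <= 1 / 2 by rewrite (ltW q0) (le_trans q4) // ler_pdivrMr //; lra.
(* This makes [expR (nu * q)] equal to [q^-1]. At t = - 2 q the quantity [q * expR (- (nu * t))] is
   then [q^-1], so that the cutoff there is at most [expR (- q^-1)], hence at most [q]. *)
pose nu := - ln q / q.
have nu0 : 0 <= nu by rewrite divr_ge0 ?(ltW q0) // oppr_ge0 ln_le0 // (le_trans q4) //
  ler_pdivrMr //; lra.
have nuq : nu * q = - ln q by rewrite /nu divfK // gt_eqF.
have [N N0 hN] : exists2 N : nat, (0 < N)%N & q * expR (nu * a) <= N%:R.
  exists (Num.bound (q * expR (nu * a))).+1 => //.
  rewrite -natr1 (le_trans (ltW (archi_boundP _))) ?lerDl //.
  by rewrite mulr_ge0 ?expR_ge0 // ltW.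
pose g := cutoff_coef q N; pose r := iota 1 N.
(* The list encodes the test function (exp(- sg) - 1) (chi(sg) + chi(- sg) - 1), with chi the
   cutoff. Its first factor is small near 0, and away from 0 the two cutoffs add up to nearly 1.
   Paired with [F] it yields [F 1 - F 0] up to terms with coefficients of total size O(q), which
   boundedness of [F] at all frequencies controls. *)
pose s : seq (R * R) := [:: (1, 1); (-1, 0)] ++
  [seq (g k, 1 + nu * k%:R) | k <- r] ++ [seq (- g k, nu * k%:R) | k <- r] ++
  [seq (g k, 1 - nu * k%:R) | k <- r] ++ [seq (- g k, - (nu * k%:R)) | k <- r].
have sE sg : \sum_(p <- s) p.1 * expR (- (p.2 * sg)) =
    (expR (- sg) - 1) * (cutoff q nu N sg + cutoff q nu N (- sg) - 1).
  have -> : cutoff q nu N sg + cutoff q nu N (- sg) - 1 =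
    1 + (cutoff q nu N sg - 1) + (cutoff q nu N (- sg) - 1) by ring.
  rewrite !cutoffE /s !big_cat !big_map !big_cons big_nil /= mul0r oppr0 expR0 !mul1r
    mulN1r addr0.
  rewrite !mulrDr mulr1 -!addrA; congr (_ + _); congr (_ + _).
  rewrite !mulrBl !mul1r !mulr_sumr -!sumrN -!big_split /= -/r; apply: eq_bigr => k _.
  rewrite -/(g k).
  rewrite (_ : - ((1 + nu * k%:R) * sg) = - sg + - (nu * k%:R * sg)); last by ring.
  rewrite (_ : - ((1 - nu * k%:R) * sg) = - sg + - (nu * k%:R * - sg)); last by ring.
  rewrite (_ : - (- (nu * k%:R) * sg) = - (nu * k%:R * - sg)); last by ring.
  by rewrite !expRD; ring.
have sF : \sum_(p <- s) (p.1)%:C%C * F p.2 = (F 1 - F 0) + \sum_(k <- r) (g k)%:C%C *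
   (F (1 + nu * k%:R) - F (nu * k%:R) + (F (1 - nu * k%:R) - F (- (nu * k%:R)))).
  rewrite /s !big_cat !big_map !big_cons big_nil /= rmorphN1 !rmorph1 mul1r mulN1r addr0.
  congr (_ + _); rewrite -!big_split /=; apply: eq_bigr => k _.
  by rewrite rmorphN /=; ring.
have sB : normc (\sum_(k <- r) (g k)%:C%C * (F (1 + nu * k%:R) - F (nu * k%:R) +
     (F (1 - nu * k%:R) - F (- (nu * k%:R))))) <= 2 * q * (4 * M).
  apply: (le_trans (le_normc_sum _ _ _)).
  apply: (@le_trans _ _ ((\sum_(k <- r) `|g k|) * (4 * M))); last first.
    by apply: ler_wpM2r; rewrite ?mulr_ge0 // cutoff_coef_le.
  rewrite mulr_suml; apply: ler_sum => k _; rewrite Normc.normcM normc_real ler_wpM2l //.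
  have nB x y : normc (F x - F y) <= 2 * M.
    apply: (le_trans (le_normcD _ _)); rewrite normcN.
    by move: (bndF x) (bndF y); clear; lra.
  apply: (le_trans (le_normcD _ _)); move: (nB (1 + nu * k%:R) (nu * k%:R)).
  by move: (nB (1 - nu * k%:R) (- (nu * k%:R))); clear; lra.
have sD : normc (\sum_(p <- s) (p.1)%:C%C * F p.2) <= K * (q * (4 + expR a)).
  apply: dual => sg hsg; rewrite sE normrM.
  have /andP[sg1 sg2] : - a <= sg <= a by rewrite -ler_norml.
  have bnd t : `|t| <= a -> q * expR (- (nu * t)) <= N%:R.
    move=> ta; apply: le_trans hN; rewrite ler_wpM2l ?(ltW q0) // ler_expR.
    rewrite -mulrN ler_wpM2l // (le_trans (ler_norm _)) // normrN //.
  have [h1 /andP[h2 h3]] := cutoff_bounds N0 (ltW q0) (bnd _ hsg).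
  have hsg' : `|- sg| <= a by rewrite normrN.
  have [h4 /andP[h5 h6]] := cutoff_bounds N0 (ltW q0) (bnd _ hsg').
  have [small|large] := leP `|sg| (2 * q).
    apply: (@le_trans _ _ (2 * `|sg| * 1)).
      rewrite ler_pM //.
        by rewrite -[in X in _ <= X]normrN norm_expRB1_le // normrN (le_trans small) //;
          move: q4; clear; lra.
      by rewrite ler_norml; move: h2 h3 h5 h6; clear; lra.
    by have := expR_ge0 a; move: small q0; clear; nra.
  have big : `|cutoff q nu N sg + cutoff q nu N (- sg) - 1| <= q.
    wlog neg : sg hsg sg1 sg2 h1 h2 h3 hsg' h4 h5 h6 large / sg <= 0.
      have [?|/ltW sg0] := leP sg 0; first exact.
      move=> /(_ (- sg)); rewrite opprK normrN (addrC (cutoff _ _ _ (- sg))).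
      by apply => //; lra.
    have /andP[_ h7] := h1; have /andP[h8 _] := h4.
    have e1 : expR (- (nu * - sg)) <= 1.
      by rewrite -expR0 ler_expR mulrN opprK mulr_ge0_le0.
    have e2 : cutoff q nu N sg <= q.
      apply: (le_trans h7).
      have : q^-1 <= q * expR (- (nu * sg)).
        rewrite -ler_pdivrMl //.
        have -> : q^-1 * q^-1 = expR (- (nu * (- (2 * q)))).
          rewrite mulrN opprK mulrCA nuq mulrN mulr_natl mulr2n opprD expRD.
          by rewrite !expRN lnK // posrE.
        rewrite ler_expR lerN2 ler_wpM2l //.
        by move: large; rewrite ler0_norm // ltrNr => /ltW.
      move=> h; have q1 : 0 < q^-1 by rewrite invr_gt0.
      apply: (@le_trans _ _ (expR (- q^-1))); first by rewrite ler_expR lerN2.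
      rewrite expRN -[leRHS]invrK lef_pV2 ?posrE ?expR_gt0 //.
      by apply: le_trans (expR_ge1Dx _); rewrite lerDr.
    have : q * expR (- (nu * - sg)) <= q by rewrite -[leRHS]mulr1 ler_wpM2l // ltW.
    by rewrite ler_norml; move: h2 h6 e2 h8; clear; lra.
  have big2 : `|expR (- sg) - 1| <= expR a.
    have : expR (- sg) <= expR a by rewrite ler_expR lerNl.
    have := expR_gt0 (- sg); have := expR_ge1 a0; rewrite ler_norml; clear; lra.
  apply: (@le_trans _ _ (expR a * q)); first exact: ler_pM.
  by move: q0; clear; lra.
rewrite (_ : F 1 - F 0 = \sum_(p <- s) (p.1)%:C%C * F p.2 - \sum_(k <- r) (g k)%:C%C *
   (F (1 + nu * k%:R) - F (nu * k%:R) + (F (1 - nu * k%:R) - F (- (nu * k%:R))))); last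
     by rewrite sF addrK.
apply: (le_trans (le_normcD _ _)); rewrite normcN.
by move: sD sB; rewrite /Z; clear; lra.
Qed.

End exponential_duality_constant.

(** * Matrix-valued functions *)

Section matrix_calculus.
Variable R : realType.
Local Notation C := R[i].
Local Notation Re := (@complex.Re R).
Local Notation Im := (@complex.Im R).
Local Notation normc := (@Normc.normc R).

Definition mac (a b : R) (p q : nat) (A : R -> 'M[C]_(p, q)) :=
  forall i j, cac a b (fun x => A x i j).

Lemma mac_cst a b p q (A : 'M[C]_(p, q)) : mac a b (fun=> A).
Proof. by move=> i j; exact: cac_cst. Qed.

Lemma macM a b p q r (A : R -> 'M[C]_(p, q)) (B : R -> 'M[C]_(q, r)) :
  mac a b A -> mac a b B -> mac a b (fun x => A x *m B x).
Proof.
move=> hA hB i j; under eq_fun do rewrite mxE.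
by apply: cac_sum => k; apply: cacM; [exact: hA | exact: hB].
Qed.

Lemma mac_adj a b p q (A : R -> 'M[C]_(p, q)) : mac a b A -> mac a b (fun x => adjmx (A x)).
Proof. by move=> hA i j; under eq_fun do rewrite !mxE; apply: cac_conj; exact: hA. Qed.

Lemma mx_is_derive_cst p q (A : 'M[C]_(p, q)) x : mx_is_derive (fun=> A) x 0.
Proof. by move=> i j; rewrite mxE; exact: (cderive_cst x (A i j)). Qed.

Lemma mx_is_deriveM p q r (A : R -> 'M[C]_(p, q)) (B : R -> 'M[C]_(q, r)) x A' B' :
  mx_is_derive A x A' -> mx_is_derive B x B' ->
  mx_is_derive (fun t => A t *m B t) x (A' *m B x + A x *m B').
Proof.
move=> hA hB i j.
have h : cderive (fun t => \sum_k A t i k * B t k j) x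
    (\sum_k (A' i k * B x k j + A x i k * B' k j)).
  by apply: cderive_sum => k; apply: (cderiveM (hA i k) (hB k j)).
have [h1 h2] := h; rewrite 3!mxE -big_split /=.
by split; under eq_fun do rewrite mxE.
Qed.

Lemma mx_is_derive_adj p q (A : R -> 'M[C]_(p, q)) x A' :
  mx_is_derive A x A' -> mx_is_derive (fun t => adjmx (A t)) x (adjmx A').
Proof.
move=> hA i j; have [h1 h2] := cderive_conj (hA j i).
by rewrite !mxE; split; under eq_fun do rewrite !mxE.
Qed.

Lemma mx_is_derive_eq p q (A : R -> 'M[C]_(p, q)) x A' B' :
  mx_is_derive A x A' -> A' = B' -> mx_is_derive A x B'.
Proof. by move=> h <-. Qed.

Lemma adjmxM p q r (A : 'M[C]_(p, q)) (B : 'M[C]_(q, r)) :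
  adjmx (A *m B) = adjmx B *m adjmx A.
Proof. by rewrite /adjmx trmx_mul map_mxM. Qed.

Lemma adjmxK p q : cancel (@adjmx R p q) (@adjmx R q p).
Proof. by move=> A; apply/matrixP => i j; rewrite !mxE conjcK. Qed.

Lemma adjmxD p q (A B : 'M[C]_(p, q)) : adjmx (A + B) = adjmx A + adjmx B.
Proof. by apply/matrixP => i j; rewrite !mxE rmorphD. Qed.

Lemma adjmxN p q (A : 'M[C]_(p, q)) : adjmx (- A) = - adjmx A.
Proof. by apply/matrixP => i j; rewrite !mxE rmorphN. Qed.

Lemma adjmxZ p q (a : C) (A : 'M[C]_(p, q)) : adjmx (a *: A) = conjc a *: adjmx A.
Proof. by apply/matrixP => i j; rewrite !mxE rmorphM. Qed.

Lemma adjmx1 p : adjmx (1%:M : 'M[C]_p) = 1%:M.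
Proof. by rewrite /adjmx trmx1 map_mx1. Qed.

Lemma adjmx0 p q : adjmx (0 : 'M[C]_(p, q)) = 0.
Proof. by rewrite /adjmx trmx0 map_mx0. Qed.

Lemma adjmx_col p1 p2 q (A : 'M[C]_(p1, q)) (B : 'M[C]_(p2, q)) :
  adjmx (col_mx A B) = row_mx (adjmx A) (adjmx B).
Proof. by rewrite /adjmx tr_col_mx map_row_mx. Qed.

Lemma adjmx_block p1 p2 q1 q2 (A : 'M[C]_(p1, q1)) B D (E : 'M[C]_(p2, q2)) :
  adjmx (block_mx A B D E) = block_mx (adjmx A) (adjmx D) (adjmx B) (adjmx E).
Proof. by rewrite /adjmx tr_block_mx map_block_mx. Qed.

Definition sqnormc (z : C) : R := Re z ^+ 2 + Im z ^+ 2.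

Lemma sqnormc_ge0 z : 0 <= sqnormc z.
Proof. by rewrite addr_ge0 ?sqr_ge0. Qed.

Lemma sqnormcE z : sqnormc z = normc z ^+ 2.
Proof. by case: z => x y; rewrite /= sqr_sqrtr ?sqnormc_ge0 //; exact: (sqnormc_ge0 (x
  +i* y)%C). Qed.

Lemma sqnormc_eq0 z : sqnormc z = 0 -> z = 0.
Proof.
by rewrite sqnormcE => /eqP; rewrite sqrf_eq0 => /eqP /Normc.eq0_normc.
Qed.

Lemma ac_sqnormc (a b : R) (f : R -> C) : cac a b f -> abs_continuous a b (fun x =>
  sqnormc (f x)).
Proof. by move=> [h1 h2]; exact: (acD (acM h1 h1) (acM h2 h2)). Qed.

Lemma is_derive_sqnormc (f : R -> C) x z : cderive f x z ->
  is_derive x (1 : R) (fun t => sqnormc (f t)) (2 * Re (conjc (f x) * z)).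
Proof.
move=> [h1 h2]; apply: (is_derive_eq (is_deriveD (is_deriveM h1 h1) (is_deriveM h2 h2))).
by case: (f x) z {h1 h2} => ? ? [? ?]; rewrite /GRing.scale /=; ring.
Qed.

Lemma ReM_conj_le (z w : C) : 2 * Re (conjc z * w) <= sqnormc z + sqnormc w.
Proof.
by case: z w => a b [c d]; rewrite /sqnormc /=; have := sqr_ge0 (a - c); have := sqr_ge0
  (b - d); nra.
Qed.

Definition sqnormv p (y : 'cV[C]_p) : R := \sum_a sqnormc (y a 0).

Lemma sqnormv_ge0 p (y : 'cV[C]_p) : 0 <= sqnormv y.
Proof. by apply: sumr_ge0 => a _; exact: sqnormc_ge0. Qed.

Lemma sqnormv_eq0 p (y : 'cV[C]_p) : sqnormv y = 0 -> y = 0.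
Proof.
move=> /eqP; rewrite psumr_eq0 => [/allP h|a _]; last exact: sqnormc_ge0.
apply/colP => a; rewrite mxE; apply/sqnormc_eq0/eqP.
by apply: (h a); rewrite mem_index_enum.
Qed.

Lemma Re_sum (I : Type) (s : seq I) (P : pred I) (F : I -> C) :
  Re (\sum_(i <- s | P i) F i) = \sum_(i <- s | P i) Re (F i).
Proof. by elim/big_ind2: _ => // x a y b <- <-; exact: ReD. Qed.

Lemma Re_adjmx_mul p (y : 'cV[C]_p) : Re ((adjmx y *m y) 0 0) = sqnormv y.
Proof.
rewrite mxE Re_sum; apply: eq_bigr => a _; rewrite !mxE.
by case: (y a 0) => b c; rewrite /sqnormc /=; ring.
Qed.

Lemma Re_adjmx_mul_le p (y k : 'cV[C]_p) :
  2 * Re ((adjmx y *m k) 0 0) <= sqnormv y + sqnormv k.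
Proof.
rewrite mxE Re_sum mulr_sumr -big_split /=; apply: ler_sum => a _; rewrite !mxE.
exact: ReM_conj_le.
Qed.

Lemma sqnormv_col p q (y : 'cV[C]_p) (k : 'cV[C]_q) :
  sqnormv (col_mx y k) = sqnormv y + sqnormv k.
Proof.
rewrite /sqnormv big_split_ord /=; congr (_ + _); apply: eq_bigr => a _.
  by rewrite col_mxEu.
by rewrite col_mxEd.
Qed.

Lemma sqnormv_vsub p q (y : 'cV[C]_(p + q)) :
  sqnormv y = sqnormv (usubmx y) + sqnormv (dsubmx y).
Proof. by rewrite -{1}[y]vsubmxK sqnormv_col. Qed.

Lemma sqr_sum_le (I : finType) (t : I -> R) :
  (\sum_i t i) ^+ 2 <= #|I|%:R * \sum_i t i ^+ 2.
Proof.
rewrite expr2 mulr_suml.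
have -> : \sum_i t i * (\sum_j t j) = \sum_i \sum_j t i * t j.
  by apply: eq_bigr => i _; rewrite mulr_sumr.
have h : \sum_i \sum_j t i * t j <= \sum_i \sum_j (t i ^+ 2 / 2 + t j ^+ 2 / 2).
  apply: ler_sum => i _; apply: ler_sum => j _; have := sqr_ge0 (t i - t j); nra.
apply: (le_trans h); rewrite le_eqVlt; apply/orP; left; apply/eqP.
have e : \sum_i t i ^+ 2 / 2 = (\sum_i t i ^+ 2) / 2 by rewrite mulr_suml.
under eq_bigr do rewrite big_split /= sumr_const e.
rewrite big_split /= sumr_const sumrMnl e.
by rewrite -mulrnDl -splitr mulr_natl.
Qed.

Lemma ac_nonincreasing (a b : R) (p : R -> R) : 0 <= a -> a <= b ->
  abs_continuous a b p ->
  {ae leb R, forall x : R, a < x < b ->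
    exists2 dp, is_derive x (1 : R) p dp & dp <= 0} -> p b <= p a.
Proof.
move=> a0 ab acp hp; have [d d0 hd] := small_increment (ac_density0 b) ltr01.
apply: (@cousin _ (fun s t => p t <= p s) _ _ ab) => [s m t h1 h2|x _].
  exact: le_trans h2 h1.
exists d => // s t sa tb /andP[sx xt] tsd; have st := le_trans sx xt.
rewrite -subr_le0 -[leRHS](mul0r 1); apply: hd => //; first exact: le_trans sa.
  exact: ac_sub acp.
apply: filterS hp => y hy /andP[sy yt]; have [|dp h1 h2] := hy.
  by rewrite (le_lt_trans sa sy) (lt_le_trans yt tb).
by exists dp => //; rewrite mul0r.
Qed.

(** The squared distance to the initial value has zero derivative, so it cannot increase from 0. *)
Lemma cac_constant (b : R) (f : R -> C) : 0 <= b -> cac 0 b f ->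
  {ae leb R, forall x : R, 0 < x < b -> cderive f x 0} -> f b = f 0.
Proof.
move=> b0 acf hf.
have acg : cac 0 b (fun x => f x + - f 0) by apply: cacD => //; exact: cac_cst.
apply/eqP; rewrite -subr_eq0; apply/eqP/sqnormc_eq0/eqP.
rewrite eq_le sqnormc_ge0 andbT.
have e : sqnormc (f 0 + - f 0) = 0 by rewrite subrr /sqnormc /= expr0n addr0.
rewrite -[leRHS]e.
apply: (@ac_nonincreasing 0 b (fun x => sqnormc (f x + - f 0))) => //.
  exact: ac_sqnormc.
apply: filterS hf => x hx /hx h; exists 0 => //.
apply: (is_derive_eq (is_derive_sqnormc (cderiveD h (cderive_cst x (- f 0))))).
by rewrite addr0 mulr0 mulr0.
Qed.

Lemma mac_constant (b : R) p q (A : R -> 'M[C]_(p, q)) : 0 <= b -> mac 0 b A ->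
  {ae leb R, forall x : R, 0 < x < b -> mx_is_derive A x 0} -> A b = A 0.
Proof.
move=> b0 acA hA; apply/matrixP => i j; apply: (@cac_constant b (fun x => A x i j)) => //.
by apply: filterS hA => x hx /hx /(_ i j); rewrite mxE.
Qed.

End matrix_calculus.

(** * The Dirac system *)

Section dirac_system.
Variables (R : realType) (m1 m2 : nat).
Local Notation C := R[i].
Local Notation Re := (@complex.Re R).
Local Notation Im := (@complex.Im R).
Local Notation normc := (@Normc.normc R).
Local Notation J := (dirac_j R m1 m2).
Implicit Types (v : R -> 'M[C]_(m1, m2)) (z : C) (x : R).

Definition dirac_G v z x : 'M[C]_(m1 + m2) :=
  'i%C *: (z *: J + J *m dirac_V v x).

Lemma dirac_jj : J *m J = 1%:M.
Proof.
rewrite /dirac_j mulmx_block !mulmx0 !mul0mx !addr0 add0r mulmx1 mulNmx mulmxN mulmx1 opprK.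
by rewrite -scalar_mx_block.
Qed.

Lemma dirac_jV_j v x : J *m dirac_V v x *m J = - dirac_V v x.
Proof.
rewrite /dirac_j /dirac_V !mulmx_block !(mulmx0, mul0mx, addr0, add0r, mulmx1, mul1mx).
by rewrite !(mulNmx, mulmxN, mulmx1, mul1mx) opp_block_mx !oppr0.
Qed.

Lemma adj_dirac_j : adjmx J = J.
Proof. by rewrite /dirac_j adjmx_block adjmxN !adjmx1 !adjmx0. Qed.

Lemma adj_dirac_V v x : adjmx (dirac_V v x) = dirac_V v x.
Proof. by rewrite /dirac_V adjmx_block !adjmx0 adjmxK. Qed.

Lemma adj_dirac_G v z x :
  adjmx (dirac_G v z x) = - 'i%C *: (conjc z *: J + dirac_V v x *m J).
Proof.
rewrite /dirac_G adjmxZ adjmxD adjmxZ adjmxM adj_dirac_j adj_dirac_V.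
by congr (_ *: _); apply/eqP; rewrite eq_complex /= oppr0 !eqxx.
Qed.

(** The potential cancels because it is self-adjoint and j squares to 1. With [z' = conjc z] the
    right-hand side is 0, a conservation law; with [z' = z] it is - 2 Im z, which makes the form
    monotone along solutions. *)
Lemma dirac_G_jform v z z' x :
  adjmx (dirac_G v z' x) *m J + J *m dirac_G v z x = ('i%C * (z - conjc z'))%:M.
Proof.
rewrite adj_dirac_G /dirac_G -scalemxAl -scalemxAr scaleNr mulmxDl mulmxDr.
rewrite -!scalemxAl -!scalemxAr !mulmxA dirac_jj -mulmxA dirac_jj mulmx1 mul1mx.
rewrite addrC -scalerBr opprD addrACA subrr addr0 -scalerBl scalerA.
by rewrite scalemx1.
Qed.

(** Signs of the diagonal of j: with them every entry of a product with j has its own explicit rate,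
    and block computations are avoided. *)
Definition dirac_sgn (a : 'I_(m1 + m2)) : R := (-1) ^+ (m1 <= a)%N.

Lemma norm_dirac_sgn a : `|dirac_sgn a| = 1.
Proof. by rewrite /dirac_sgn normrX normrN1 expr1n. Qed.

Lemma dirac_jE : J = diag_mx (\row_a (dirac_sgn a)%:C%C).
Proof.
apply/matrixP => a b; rewrite mxE /dirac_sgn !mxE.
case: split_ordP => a' ->; rewrite mxE; case: split_ordP => b' ->; rewrite !mxE.
- by rewrite eq_lshift /= leqNgt ltn_ord expr0 rmorph1.
- by rewrite eq_lrshift mulr0n.
- by rewrite eq_rlshift mulr0n.
- by rewrite eq_rshift /= leq_addr expr1 rmorphN1 mulNrn.
Qed.

Lemma mul_dirac_jE q (A : 'M[C]_(m1 + m2, q)) a b :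
  (J *m A) a b = (dirac_sgn a)%:C%C * A a b.
Proof. by rewrite dirac_jE mul_diag_mx !mxE. Qed.

Lemma mul_mx_dirac_jE q (A : 'M[C]_(q, m1 + m2)) a b :
  (A *m J) a b = A a b * (dirac_sgn b)%:C%C.
Proof. by rewrite dirac_jE mul_mx_diag !mxE. Qed.

Lemma sum_dirac_upper (F : 'I_(m1 + m2) -> R) :
  \sum_(a : 'I_(m1 + m2) | (a < m1)%N) F a = \sum_a F (lshift m2 a).
Proof.
rewrite big_mkcond big_split_ord /= [X in _ + X]big1 ?addr0.
  by apply: eq_bigr => a _; rewrite ltn_ord.
by move=> a _; rewrite ltnNge leq_addr.
Qed.

Lemma sum_dirac_lower (F : 'I_(m1 + m2) -> R) :
  \sum_(a : 'I_(m1 + m2) | (m1 <= a)%N) F a = \sum_a F (rshift m1 a).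
Proof.
rewrite big_mkcond big_split_ord /= [X in X + _]big1 ?add0r.
  by apply: eq_bigr => a _; rewrite leq_addr.
by move=> a _; rewrite leqNgt ltn_ord.
Qed.

Lemma solution_mac v z n (y : R -> 'M[C]_(m1 + m2, n)) l :
  dirac_solution v z y -> mac 0 l y.
Proof. by move=> [h _]; exact: h. Qed.

Lemma solution_derive v z n (y : R -> 'M[C]_(m1 + m2, n)) : dirac_solution v z y ->
  {ae leb R, forall x : R, 0 < x -> mx_is_derive y x (dirac_G v z x *m y x)}.
Proof. by move=> [_]; apply: filterS => x h /h; rewrite scalemxAl. Qed.

Section fundamental.
Variables (v : R -> 'M[C]_(m1, m2)) (u : R -> C -> 'M[C]_(m1 + m2)).
Hypothesis fund : fundamental_solution v u.

Lemma fundamental_mac l z : mac 0 l (u^~ z).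
Proof. by case: (fund z) => /(@solution_mac _ _ _ _ l). Qed.

Lemma fundamental_derive z :
  {ae leb R, forall x : R, 0 < x -> mx_is_derive (u^~ z) x (dirac_G v z x *m u x z)}.
Proof. by case: (fund z) => /solution_derive. Qed.

Lemma fundamental_jform z x : 0 <= x ->
  adjmx (u x (conjc z)) *m J *m u x z = J.
Proof.
move=> x0.
have := @mac_constant R x _ _ (fun t => adjmx (u t (conjc z)) *m J *m u t z) x0.
rewrite !(fund _).2 adjmx1 mul1mx mulmx1; apply.
  apply: macM; last exact: fundamental_mac.
  by apply: macM; [apply: mac_adj; exact: fundamental_mac | exact: mac_cst].
apply: filterS2 (fundamental_derive z) (fundamental_derive (conjc z)) => t h1 h2 /andP[t0 _].
apply: (mx_is_derive_eq (mx_is_deriveM (mx_is_deriveM (mx_is_derive_adj (h2 t0))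
  (mx_is_derive_cst J t)) (h1 t0))).
rewrite mulmx0 addr0 adjmxM -!mulmxA -mulmxDr !mulmxA -mulmxDl dirac_G_jform conjcK subrr mulr0.
by rewrite -scalemx1 scale0r mul0mx mulmx0.
Qed.

Lemma fundamental_jform_adj z x : 0 <= x ->
  u x z *m J *m adjmx (u x (conjc z)) = J.
Proof.
move=> x0.
have h : (J *m adjmx (u x (conjc z)) *m J) *m u x z = 1%:M.
  by rewrite -!mulmxA [adjmx _ *m _]mulmxA fundamental_jform // dirac_jj.
have /(congr1 (mulmx^~ J)) := mulmx1C h.
by rewrite mul1mx !mulmxA -[_ *m J *m J]mulmxA dirac_jj mulmx1.
Qed.

Lemma fundamental_inj n z x (h : 'M[C]_(m1 + m2, n)) : 0 <= x ->
  u x z *m h = 0 -> h = 0.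
Proof.
move=> x0 /(congr1 (mulmx (J *m (adjmx (u x (conjc z)) *m J)))).
by rewrite mulmx0 mulmxA -[J *m _ *m u x z]mulmxA fundamental_jform // dirac_jj mul1mx.
Qed.

Definition potential_density x : R := \sum_a \sum_b normc (dirac_V v x a b).

Lemma potential_density_ge0 x : 0 <= potential_density x.
Proof. by apply: sumr_ge0 => a _; apply: sumr_ge0 => b _; exact: normc_ge0. Qed.

Lemma normc_potential_row x a : \sum_b normc (dirac_V v x a b) <= potential_density x.
Proof.
rewrite /potential_density [leRHS](bigD1 a) //= lerDl.
by apply: sumr_ge0 => c _; apply: sumr_ge0 => b _; exact: normc_ge0.
Qed.

(* The potential is recovered from the solution at z = 0, so the absolute
   continuity of that solution provides the density. *)
Lemma potential_ac_density l : ac_density l potential_density.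
Proof.
pose D x := dirac_G v 0 x *m u x 0.
have /choice [Kf hKf] : forall cb : 'I_(m1 + m2) * 'I_(m1 + m2), exists K : R,
    forall x, 0 <= x <= l -> normc (u x 0 cb.1 cb.2) <= K.
  by move=> [c b]; exact: cac_bounded (@fundamental_mac l 0 c b).
pose W x := \sum_a \sum_b \sum_c `|Kf (b, c)| * (`|Re (D x a c)| + `|Im (D x a c)|).
have hW : ac_density l W.
  apply: ac_density_sum => a; apply: ac_density_sum => b; apply: ac_density_sum => c.
  apply: ac_densityZ => //.
  have [h1 h2] := @fundamental_mac l 0 a c.
  apply: ac_densityD.
    apply: (ac_density_derive h1); apply: filterS (fundamental_derive 0).
    by move=> x h /andP[/h /(_ a c) [h' _] _].
  apply: (ac_density_derive h2); apply: filterS (fundamental_derive 0).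
  by move=> x h /andP[/h /(_ a c) [_ h'] _].
apply: ac_density_le hW _; apply: filterE => x /andP[x0 xl].
(* By [fundamental_jform_adj] the inverse of [u x 0] is [J *m adjmx (u x 0) *m J], and the
   derivative [D x] times this inverse is i j V. *)
have VE : dirac_V v x = - 'i%C *: (J *m D x *m J *m adjmx (u x 0) *m J).
  rewrite /D /dirac_G scale0r add0r -scalemxAl -!scalemxAr -!scalemxAl scalerA.
  rewrite mulNr -expr2 sqr_i opprK scale1r !mulmxA dirac_jj mul1mx.
  have := @fundamental_jform_adj 0 x (ltW x0); rewrite conjc0 => h.
  by rewrite -!mulmxA (mulmxA (u x 0)) (mulmxA _ _ J) h dirac_jj mulmx1.
apply: ler_sum => a _; apply: ler_sum => b _.
rewrite VE mxE Normc.normcM normcN (_ : normc 'i%C = 1) ?mul1r; last first.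
  by rewrite /= expr0n expr1n add0r sqrtr1.
rewrite mul_mx_dirac_jE Normc.normcM normc_real norm_dirac_sgn mulr1 mxE.
apply: (le_trans (le_normc_sum _ _ _)); apply: ler_sum => c _.
rewrite mul_mx_dirac_jE mul_dirac_jE !mxE !Normc.normcM !normc_real !norm_dirac_sgn mul1r mulr1.
rewrite mulrC ler_pM ?normc_ge0 //; last exact: normc_le_ReIm.
rewrite (_ : normc (conjc _) = normc (u x 0 b c)); last first.
  by case: (u x 0 b c) => ? ?; rewrite /= sqrrN.
by apply: le_trans (ler_norm _); apply: (hKf (b, c)); rewrite (ltW x0) (ltW xl).
Qed.

End fundamental.

End dirac_system.

(** * Weyl solutions *)

Section weyl.
Variable R : realType.
Local Notation C := R[i].
Local Notation Re := (@complex.Re R).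
Local Notation normc := (@Normc.normc R).

Lemma leb_measurable_itv (i : interval R) : measurable ([set` i] : set (lebesgueType R)).
Proof. by apply: sub_caratheodory; exact: (measurable_itv i). Qed.

Lemma integrable_not_ge_cst (I : finType) (f : I -> R -> R) (x0 c : R) :
  0 < c -> 0 <= x0 ->
  (forall i, (leb R).-integrable `[0, +oo[ (EFin \o f i)) ->
  ~ (forall x, x0 <= x -> c <= \sum_i f i x).
Proof.
move=> c0 x00 intf h.
have m0 := leb_measurable_itv `[0%R, +oo[; have m1 := leb_measurable_itv `[x0, +oo[.
have intS : (leb R).-integrable `[0, +oo[ (fun x => \sum_i (EFin \o f i) x)%E.
  by apply: integrable_sum => // i _; exact: intf.
have : (leb R).-integrable `[x0, +oo[ (fun x => \sum_i (EFin \o f i) x)%E.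
  apply: integrableS intS => // x /=; rewrite !in_itv /= !andbT; exact: le_trans.
move=> /integrableP [mS]; apply/negP; rewrite -leNgt.
apply: (@le_trans _ _ (\int[leb R]_(x in `[x0, +oo[) (cst c%:E x))%E); last first.
  apply: ge0_le_integral.
  - exact: m1.
  - by move=> x _; rewrite lee_fin ltW.
  - exact: measurable_cst.
  - exact: measurableT_comp.
  - move=> x /=; rewrite in_itv /= andbT => /h hx; rewrite sumEFin /=.
    by rewrite lee_fin (le_trans hx) // ler_norm.
rewrite integral_cst //.
rewrite [X in (_ * X)%E](_ : _ = +oo%E) ?gt0_muley ?lte_fin //.
by apply: (etrans (@lebesgue_measure_itv R `[x0, +oo[)); rewrite /= ltry.
Qed.

Lemma is_derive_bigsum (I : Type) (s : seq I) (P : pred I) (F : I -> R -> R) (D : I -> R)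
  (x : R) :
  (forall i, is_derive x (1 : R) (F i) (D i)) ->
  is_derive x (1 : R) (fun t => \sum_(i <- s | P i) F i t) (\sum_(i <- s | P i) D i).
Proof.
move=> h; elim: s => [|i s ih].
  by rewrite big_nil; under eq_fun do rewrite big_nil; exact: is_derive_cst.
under eq_fun do rewrite big_cons.
by rewrite big_cons; case: (P i) => //; exact: (is_deriveD (h i) ih).
Qed.

Lemma ac_bigsum (a b : R) (I : Type) (s : seq I) (P : pred I) (F : I -> R -> R) :
  (forall i, abs_continuous a b (F i)) ->
  abs_continuous a b (fun t => \sum_(i <- s | P i) F i t).
Proof.
move=> h; elim: s => [|i s ih].
  by under eq_fun do rewrite big_nil; exact: ac_cst.
by under eq_fun do rewrite big_cons; case: (P i) => //; exact: (acD (h i) ih).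
Qed.

Lemma Re_le_normc (z : C) : Re z <= normc z.
Proof. exact: le_trans (ler_norm _) (ger_normc_Re z). Qed.

Lemma normc_conj (z : C) : normc (conjc z) = normc z.
Proof. by case: z => a b; rewrite /= sqrrN. Qed.

Lemma sqnormc_derive_le (I : finType) (kappa mu w : R) (y : I -> C) (r : C) (a : I) :
  mu <= kappa -> 0 <= w -> normc r <= w * \sum_b normc (y b) ->
  2 * Re (conjc (y a) * (mu%:C%C * y a + r)) <=
  2 * kappa * sqnormc (y a) + w * (#|I|%:R * sqnormc (y a) + \sum_b sqnormc (y b)).
Proof.
move=> hmu w0 hr; rewrite mulrDr ReD mulrDr; apply: lerD.
  rewrite (_ : 2 * _ = 2 * mu * sqnormc (y a)); last first.
    by case: (y a) => ? ?; rewrite /sqnormc /=; ring.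
  by rewrite ler_wpM2r ?sqnormc_ge0 // ler_pM2l.
have h1 : 2 * Re (conjc (y a) * r) <= 2 * (normc (y a) * (w * \sum_b normc (y b))).
  rewrite ler_pM2l // (le_trans (Re_le_normc _)) // Normc.normcM normc_conj.
  by rewrite ler_wpM2l ?normc_ge0.
apply: (le_trans h1); rewrite (_ : 2 * _ = w * (2 * normc (y a) * \sum_b normc (y b)));
  last by ring.
have e : \sum_(b : I) sqnormc (y a) = #|I|%:R * sqnormc (y a) by rewrite sumr_const mulr_natl.
rewrite ler_wpM2l // -e mulr_sumr -big_split /=; apply: ler_sum => b _.
by rewrite !sqnormcE; have := sqr_ge0 (normc (y a) - normc (y b)); clear; lra.
Qed.

(** The weight [expR (- (2 * kappa) * x)] removes the diagonal part, and domination by the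
    components in [S] closes the inequality on their energy alone. [K] comes from [w] and [I], hence
    is uniform in [kappa] and [mu]. *)
Lemma weighted_growth (l : R) (w : R -> R) (I : finType) :
  ac_density l w -> (forall x, 0 <= w x) ->
  exists2 K : R, 0 <= K & forall (S : pred I) (kappa : R) (mu : I -> R) (y : I -> R -> C),
    (forall a, cac 0 l (y a)) -> (forall a, S a -> mu a <= kappa) ->
    {ae leb R, forall x : R, 0 < x < l -> exists2 r : I -> C,
      forall a, cderive (y a) x ((mu a)%:C%C * y a x + r a) &
      forall a, normc (r a) <= w x * \sum_b normc (y b x)} ->
    (forall x, 0 <= x <= l ->
      \sum_b sqnormc (y b x) <= 2 * \sum_(b | S b) sqnormc (y b x)) ->
    forall x, 0 <= x <= l ->
      \sum_(a | S a) sqnormc (y a x) <=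
      K * expR (2 * kappa * x) * \sum_(a | S a) sqnormc (y a 0).
Proof.
(* In the factor 3, one part comes from the squares of the components in [S] and two from the sum
   over all components, which domination bounds by twice the energy in [S]. *)
move=> hw w0; have c0 : (0 : R) <= 3 * #|I|%:R by rewrite mulr_ge0.
have [|K K0 hK] := gronwall (ac_densityZ c0 hw); first by move=> x; rewrite mulr_ge0.
exists K => // S kappa mu y acy hmu hy hS x xl.
pose P t := \sum_(a | S a) sqnormc (y a t).
have P0 t : 0 <= P t by apply: sumr_ge0 => a _; exact: sqnormc_ge0.
have := hK (fun t => expR (- (2 * kappa) * t) * P t); rewrite mulr0 expR0 mul1r => h.
rewrite -(ler_pM2l (expR_gt0 (- (2 * kappa) * x))) -/(P x) -/(P 0).
rewrite (_ : _ * (K * _ * _) = K * P 0); last first.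
  rewrite -mulrA mulrCA; congr (_ * _).
  by rewrite mulrA -expRD mulNr addNr expR0 mul1r.
apply: h => // [|t|].
- apply: acM; first exact: ac_expR.
  by apply: ac_bigsum => a; exact: ac_sqnormc.
- by rewrite mulr_ge0 ?expR_ge0.
apply: filterS hy => t ht tl; have [r hr1 hr2] := ht tl.
have tl' : 0 <= t <= l by case/andP: tl => /ltW -> /ltW ->.
have dP := @is_derive_bigsum I (index_enum I) S (fun a t => sqnormc (y a t)) _ t
  (fun a => is_derive_sqnormc (hr1 a)).
have dE := is_derive_expRM (- (2 * kappa)) t.
eexists; first exact: (is_deriveM dE dP).
rewrite /GRing.scale /= -/(P t).
set E := expR _; have E0 : 0 <= E by exact: expR_ge0.
have bound : \sum_(a | S a) 2 * Re (conjc (y a t) * ((mu a)%:C%C * y a t + r a)) <=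
    2 * kappa * P t + 3 * #|I|%:R * w t * P t.
  apply: (@le_trans _ _ (\sum_(a | S a) (2 * kappa * sqnormc (y a t) +
      w t * (#|I|%:R * sqnormc (y a t) + 2 * P t)))).
    apply: ler_sum => a Sa.
    apply: (le_trans (sqnormc_derive_le a (hmu a Sa) (w0 t) (hr2 a))).
    by rewrite lerD2l ler_wpM2l // lerD2l; exact: hS.
  rewrite big_split /= -mulr_sumr -/(P t) lerD2l -mulr_sumr big_split /= -mulr_sumr -/(P t).
  rewrite sumr_const (_ : 3 * _ * _ * _ = w t * (#|I|%:R * P t + #|I|%:R * (2 * P t)));
    last by ring.
  by rewrite ler_wpM2l // lerD2l -[_ *+ #|_|]mulr_natl ler_wpM2r ?mulr_ge0 // ler_nat max_card.
have := ler_wpM2l E0 bound; clear; lra.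
Qed.

End weyl.

(** * Growth of solutions at purely imaginary spectral parameters *)

Section weyl_dirac.
Variables (R : realType) (m1 m2 : nat).
Local Notation C := R[i].
Local Notation normc := (@Normc.normc R).
Local Notation J := (dirac_j R m1 m2).
Local Notation zeta eta := (Complex 0 eta : C).

Lemma dirac_G_mulE (v : R -> 'M[C]_(m1, m2)) (eta x : R) n (y : 'M[C]_(m1 + m2, n)) a b :
  (dirac_G v (zeta eta) x *m y) a b =
  (- (eta * dirac_sgn R a))%:C%C * y a b + 'i%C * ((dirac_sgn R a)%:C%C * (dirac_V v x *m
    y) a b).
Proof.
rewrite /dirac_G -scalemxAl mxE mulmxDl mxE -scalemxAl mxE -mulmxA !mul_dirac_jE mulrDr.
congr (_ + _); rewrite !mulrA; congr (_ * _).
by apply/eqP; rewrite eq_complex /=; apply/andP; split; apply/eqP; ring.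
Qed.

Lemma jform_sub (y k : 'cV[C]_(m1 + m2)) : adjmx y *m J *m k =
  adjmx (usubmx y) *m usubmx k - adjmx (dsubmx y) *m dsubmx k.
Proof.
rewrite -{1}[y]vsubmxK -{1}[k]vsubmxK adjmx_col /dirac_j mul_row_block mul_row_col.
by rewrite !mulmx0 addr0 add0r mulmx1 mulmxN mulmx1 mulNmx.
Qed.

Section estimates.
Variables (v : R -> 'M[C]_(m1, m2)) (u : R -> C -> 'M[C]_(m1 + m2)).
Hypothesis fund : fundamental_solution v u.

Lemma column_mac l z n (h : 'M[C]_(m1 + m2, n)) : mac 0 l (fun x => u x z *m h).
Proof. exact: (macM (fundamental_mac fund l z) (mac_cst 0 l h)). Qed.

Lemma column_derive z n (h : 'M[C]_(m1 + m2, n)) :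
  {ae leb R, forall x : R, 0 < x ->
    mx_is_derive (fun x => u x z *m h) x (dirac_G v z x *m (u x z *m h))}.
Proof.
apply: filterS (fundamental_derive fund z) => x hx /hx hd.
apply: (mx_is_derive_eq (mx_is_deriveM hd (mx_is_derive_cst h x))).
by rewrite mulmx0 addr0 mulmxA.
Qed.

(** One constant serves both decaying columns, with [S] a dominating block, and growing ones, with
    [S] everything. Only the components of [h] in [S] enter the bound. *)
Lemma column_growth (l : R) : exists2 K : R, 0 <= K &
  forall (S : pred 'I_(m1 + m2)) (kappa eta : R) (h : 'cV[C]_(m1 + m2)),
    (forall a, S a -> - (eta * dirac_sgn R a) <= kappa) ->
    (forall x, 0 <= x <= l -> sqnormv (u x (zeta eta) *m h) <=
       2 * \sum_(a | S a) sqnormc ((u x (zeta eta) *m h) a 0)) ->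
    forall x, 0 <= x <= l ->
      sqnormv (u x (zeta eta) *m h) <=
      K * expR (2 * kappa * x) * \sum_(a | S a) sqnormc (h a 0).
Proof.
have [K K0 hK] := @weighted_growth R l _ 'I_(m1 + m2) (potential_ac_density fund l)
  (potential_density_ge0 v).
exists (2 * K) => [|S kappa eta h hS hS2 x xl]; first by rewrite mulr_ge0.
apply: (le_trans (hS2 x xl)); rewrite -!mulrA ler_pM2l // !mulrA.
have := hK S kappa (fun a => - (eta * dirac_sgn R a)) (fun a x => (u x (zeta eta) *m h) a 0).
rewrite (fund _).2 mul1mx; apply => //.
  by move=> a; exact: column_mac.
apply: filterS (column_derive (zeta eta) h) => t ht /andP[t0 _].
exists (fun a => 'i%C * ((dirac_sgn R a)%:C%C * (dirac_V v t *m (u t (zeta eta) *m h)) a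
  0)) => a.
  by have := ht t0 a 0; rewrite dirac_G_mulE.
rewrite !Normc.normcM normc_real norm_dirac_sgn mul1r.
rewrite (_ : normc 'i%C = 1) ?mul1r; last by rewrite /= expr0n expr1n add0r sqrtr1.
rewrite mxE (le_trans (le_normc_sum _ _ _)) // mulr_sumr; apply: ler_sum => b _.
rewrite Normc.normcM ler_wpM2r ?normc_ge0 //.
apply: le_trans (normc_potential_row v t a).
by rewrite (bigD1 b) //= lerDl; apply: sumr_ge0 => c _; exact: normc_ge0.
Qed.

End estimates.
End weyl_dirac.

(** * Decay of Weyl solutions and boundedness of the transfer function *)

Section weyl_estimates.
Variables (R : realType) (m1 m2 : nat).
Local Notation C := R[i].
Local Notation Re := (@complex.Re R).
Local Notation normc := (@Normc.normc R).
Local Notation J := (dirac_j R m1 m2).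
Local Notation zeta eta := (Complex 0 eta : C).

Definition weyl_summable (u : R -> C -> 'M[C]_(m1 + m2)) (z : C) (phi : 'M[C]_(m2, m1)) :=
  mx_summable `[0, +oo[ (fun x =>
    row_mx 1%:M (adjmx phi) *m adjmx (u x z) *m u x z *m col_mx 1%:M phi).

Lemma Re_gram p q (A : 'M[C]_(p, q)) b :
  Re ((adjmx A *m A) b b) = \sum_a sqnormc (A a b).
Proof.
rewrite mxE Re_sum; apply: eq_bigr => a _.
by rewrite !mxE; case: (A a b) => ? ?; rewrite /sqnormc /=; ring.
Qed.

Lemma sqnormv_mul_le p q (A : 'M[C]_(p, q)) (f : 'cV[C]_q) :
  sqnormv (A *m f) <= q%:R * sqnormv f * \sum_b Re ((adjmx A *m A) b b).
Proof.
have e : \sum_b Re ((adjmx A *m A) b b) = \sum_a \sum_b sqnormc (A a b).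
  by rewrite exchange_big /=; apply: eq_bigr => b _; exact: Re_gram.
rewrite e mulr_sumr; apply: ler_sum => a _; rewrite mxE sqnormcE.
apply: (@le_trans _ _ ((\sum_b normc (A a b * f b 0)) ^+ 2)).
  by rewrite lerXn2r ?nnegrE ?normc_ge0 ?sumr_ge0 ?le_normc_sum // => b _; exact: normc_ge0.
apply: (le_trans (sqr_sum_le _)); rewrite card_ord -mulrA ler_wpM2l // mulr_sumr.
apply: ler_sum => b _; rewrite Normc.normcM exprMn -!sqnormcE mulrC ler_wpM2r ?sqnormc_ge0 //.
by rewrite /sqnormv (bigD1 b) //= lerDl sumr_ge0 // => c _; exact: sqnormc_ge0.
Qed.

Lemma Re_jform (y : 'cV[C]_(m1 + m2)) :
  Re ((adjmx y *m J *m y) 0 0) = sqnormv (usubmx y) - sqnormv (dsubmx y).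
Proof.
rewrite jform_sub -!Re_adjmx_mul; move: (adjmx (usubmx y) *m _) (adjmx (dsubmx y) *m _) => A B.
by rewrite !mxE; case: (A 0 0) (B 0 0) => ? ? [].
Qed.

(** The left-hand side is the derivative of y^* j y in the shape in which the product rule for three
    factors, the middle one constant, delivers it. *)
Lemma dirac_jform_column (v : R -> 'M[C]_(m1, m2)) eta x (y : 'cV[C]_(m1 + m2)) :
  (adjmx (dirac_G v (zeta eta) x *m y) *m J + adjmx y *m 0) *m y +
    adjmx y *m J *m (dirac_G v (zeta eta) x *m y) =
  (- (2 * eta))%:C%C *: (adjmx y *m y).
Proof.
rewrite mulmx0 addr0 adjmxM -!mulmxA -mulmxDr !mulmxA -mulmxDl dirac_G_jform.
rewrite mul_scalar_mx -scalemxAr; congr (_ *: _).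
by apply/eqP; rewrite eq_complex /=; apply/andP; split; apply/eqP; ring.
Qed.

Section one_system.
Variables (v : R -> 'M[C]_(m1, m2)) (u : R -> C -> 'M[C]_(m1 + m2)).
Hypothesis fund : fundamental_solution v u.
Variables (eta : R) (phi : 'M[C]_(m2, m1)).
Hypothesis (eta0 : 0 < eta) (summ : weyl_summable u (zeta eta) phi).

(* The indefinite form y^* j y decreases along solutions; were it negative
   somewhere, y would stay bounded away from 0 and not be square-summable. *)
Lemma weyl_lower_le_upper x (f : 'cV[C]_m1) : 0 <= x ->
  sqnormv (dsubmx (u x (zeta eta) *m (col_mx 1%:M phi *m f))) <=
  sqnormv (usubmx (u x (zeta eta) *m (col_mx 1%:M phi *m f))).
Proof.
move=> x0; set h := col_mx 1%:M phi *m f.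
pose y t := u t (zeta eta) *m h; rewrite -/(y x).
pose Q t := Re ((adjmx (y t) *m J *m y t) 0 0).
rewrite -subr_ge0 -Re_jform -/(Q x) leNgt; apply/negP => Qx.
have Qdecr t : x <= t -> Q t <= Q x.
  move=> xt; apply: (@ac_nonincreasing R x t Q) => //.
    apply: (@ac_sub _ 0 t) => //.
    have ym := @column_mac R m1 m2 v u fund t (zeta eta) 1 h.
    by have [] := macM (macM (mac_adj ym) (mac_cst 0 t J)) ym 0 0.
  apply: filterS (column_derive fund (zeta eta) h) => s hs /andP[xs _].
  have s0 : 0 < s := le_lt_trans x0 xs.
  have hd : mx_is_derive y s (dirac_G v (zeta eta) s *m y s) := hs s0.
  have [h1 _] := mx_is_deriveM (mx_is_deriveM (mx_is_derive_adj hd) (mx_is_derive_cst J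
    s)) hd 0 0.
  eexists; first exact: h1.
  rewrite dirac_jform_column mxE.
  rewrite ReM /= mul0r subr0 Re_adjmx_mul mulNr oppr_le0.
  by rewrite mulr_ge0 ?sqnormv_ge0 // mulr_ge0 // ltW.
(* The squared norm of [y t] is at most [D] times the trace of the summable matrix; [D + 1] serves
   as divisor since [D] could vanish. *)
pose D := m1%:R * sqnormv f.
have D0 : 0 <= D by rewrite mulr_ge0 ?sqnormv_ge0.
have D1 : 0 < D + 1 by rewrite ltr_wpDl.
pose W t := row_mx 1%:M (adjmx phi) *m adjmx (u t (zeta eta)) *m u t (zeta eta)
  *m col_mx 1%:M phi.
have WE t : W t = adjmx (u t (zeta eta) *m col_mx 1%:M phi) *m (u t (zeta eta) *m col_mx
  1%:M phi).
  by rewrite adjmxM adjmx_col adjmx1 !mulmxA.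
apply: (@integrable_not_ge_cst R 'I_m1 (fun b t => Re (W t b b)) x (- Q x / (D + 1))) => //.
- by rewrite divr_gt0 // oppr_gt0.
- by move=> b; have [] := summ b b.
move=> t xt; rewrite ler_pdivrMr // mulrC.
have := sqnormv_mul_le (u t (zeta eta) *m col_mx 1%:M phi) f; rewrite -WE -mulmxA -/h
  -/(y t) -/D => hy.
have S0 : 0 <= \sum_b Re (W t b b).
  apply: sumr_ge0 => b _; rewrite WE Re_gram.
  by apply: sumr_ge0 => a _; exact: sqnormc_ge0.
have : - Q t <= sqnormv (y t).
  rewrite /Q Re_jform opprB sqnormv_vsub addrC lerD2r.
  by apply: (@le_trans _ _ 0); rewrite ?oppr_le0 sqnormv_ge0.
by move: (Qdecr t xt) hy S0; clear; lra.
Qed.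

(** A vector killed by the upper block is killed by the dominated lower block too, and then vanishes
    because [u x (zeta eta)] is injective. *)
Lemma weyl_upper_unit x : 0 <= x ->
  usubmx (u x (zeta eta) *m col_mx 1%:M phi) \in unitmx.
Proof.
move=> x0; rewrite unitmxE unitfE -det_tr; apply/negP => /det0P [h h0 hY].
have /(congr1 trmx) := hY; rewrite trmx_mul trmxK trmx0 mul_usub_mx => hY1.
have := @weyl_lower_le_upper x h^T x0; rewrite !mulmxA hY1.
rewrite [leRHS]/sqnormv big1 => [le0|a _]; last by rewrite mxE /sqnormc /= expr0n addr0.
have /sqnormv_eq0 hY2 : sqnormv (dsubmx (u x (zeta eta) *m col_mx 1%:M phi *m h^T)) = 0.
  by apply/eqP; rewrite eq_le le0 sqnormv_ge0.
have : u x (zeta eta) *m (col_mx 1%:M phi *m h^T) = 0.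
  by rewrite mulmxA -[LHS]vsubmxK hY1 hY2 col_mx0.
move=> /(fundamental_inj fund x0); rewrite mul_col_mx mul1mx => /eqP.
rewrite col_mx_eq0 => /andP[/eqP hT _].
by move: h0; rewrite -[h]trmxK hT trmx0 eqxx.
Qed.

(** The column [psi] is j-orthogonal to all Weyl columns at the conjugate parameter. Taking the Weyl
    column with the same upper part, the squared norm of that part equals the inner product of the
    two lower parts; since the Weyl lower part is dominated, the claim follows from 2 Re <a, b> <=
    |a|^2 + |b|^2. *)
Lemma weyl_upper_le_lower_conj x (g : 'cV[C]_m2) : 0 <= x ->
  sqnormv (usubmx (u x (zeta (- eta)) *m (col_mx (adjmx phi) 1%:M *m g))) <=
  sqnormv (dsubmx (u x (zeta (- eta)) *m (col_mx (adjmx phi) 1%:M *m g))).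
Proof.
move=> x0; set psi := u x (zeta (- eta)) *m _.
pose Y := u x (zeta eta) *m col_mx 1%:M phi.
pose h := invmx (usubmx Y) *m usubmx psi.
have Yu : usubmx (Y *m h) = usubmx psi.
  by rewrite -mul_usub_mx mulmxA mulmxV ?mul1mx //; exact: weyl_upper_unit.
have Yd : sqnormv (dsubmx (Y *m h)) <= sqnormv (usubmx psi).
  by rewrite -Yu /Y -mulmxA; exact: weyl_lower_le_upper.
have : adjmx psi *m J *m (Y *m h) = 0.
  rewrite /psi adjmxM /Y -!mulmxA (mulmxA J) (mulmxA (adjmx (u _ _))) (mulmxA (adjmx (u _ _))).
  rewrite (@fundamental_jform R m1 m2 v u fund (zeta eta) x x0).
  rewrite adjmxM adjmx_col adjmxK adjmx1 -mulmxA (mulmxA J) (mulmxA (row_mx _ _)).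
  rewrite /dirac_j mul_block_col !mulmx1 !mul0mx addr0 add0r mulNmx mul1mx mul_row_col.
  by rewrite mulmx1 mul1mx addrN mul0mx mulmx0.
rewrite jform_sub Yu => /eqP; rewrite subr_eq0 => /eqP e.
have := Re_adjmx_mul (usubmx psi); rewrite e => e'.
have := Re_adjmx_mul_le (dsubmx psi) (dsubmx (Y *m h)); rewrite e'.
by move: Yd; clear; lra.
Qed.

End one_system.

Lemma col_mulmx p q r (A : 'M[C]_(p, q)) (B : 'M[C]_(q, r)) c :
  col c (A *m B) = A *m col c B.
Proof. by rewrite !colE mulmxA. Qed.

(** The reciprocal rates cancel in each product of entries, leaving the square root of [K1 * K2],
    which is at most [K1 + K2]. *)
Lemma mulmx_adj_bound p q r (A : 'M[C]_(p, q)) (B : 'M[C]_(r, q)) (K1 K2 t : R) :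
  (forall c, sqnormv (col c A) <= K1 * expR (- t)) ->
  (forall c, sqnormv (col c B) <= K2 * expR t) ->
  forall a b, normc ((A *m adjmx B) a b) <= q%:R * (K1 + K2).
Proof.
move=> hA hB a b; rewrite mxE (le_trans (le_normc_sum _ _ _)) //.
rewrite -[q in q%:R]card_ord mulr_natl -sumr_const; apply: ler_sum => c _.
rewrite !mxE Normc.normcM normc_conj.
have h1 : normc (A a c) ^+ 2 <= K1 * expR (- t).
  apply: le_trans (hA c); rewrite -sqnormcE /sqnormv (bigD1 a) //= mxE lerDl.
  by apply: sumr_ge0 => i _; exact: sqnormc_ge0.
have h2 : normc (B b c) ^+ 2 <= K2 * expR t.
  apply: le_trans (hB c); rewrite -sqnormcE /sqnormv (bigD1 b) //= mxE lerDl.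
  by apply: sumr_ge0 => i _; exact: sqnormc_ge0.
have E0 := expR_gt0 t; have E0' := expR_gt0 (- t).
have E1 : expR t * expR (- t) = 1 by rewrite -expRD subrr expR0.
have h3 : expR t * normc (A a c) ^+ 2 <= K1.
  by move: h1; rewrite -(ler_pM2l E0) (mulrCA _ K1) E1 mulr1.
have h4 : expR (- t) * normc (B b c) ^+ 2 <= K2.
  by move: h2; rewrite -(ler_pM2l E0') (mulrCA _ K2) (mulrC (expR (- t)) (expR t)) E1 mulr1.
have h5 := normc_ge0 (A a c); have h6 := normc_ge0 (B b c).
have K10 : 0 <= K1 by apply: le_trans h3; rewrite mulr_ge0 ?sqr_ge0 // ltW.
have K20 : 0 <= K2 by apply: le_trans h4; rewrite mulr_ge0 ?sqr_ge0 // ltW.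
rewrite -(@ler_pXn2r _ 2) ?nnegrE ?mulr_ge0 ?addr_ge0 //.
apply: (@le_trans _ _ (K1 * K2)).
  rewrite (_ : _ ^+ 2 = (expR t * normc (A a c) ^+ 2) * (expR (- t) * normc (B b c) ^+ 2)).
    by apply: ler_pM => //; rewrite mulr_ge0 ?sqr_ge0 // ltW.
  by rewrite mulrACA E1 mul1r exprMn.
by have := mulr_ge0 K10 K20; have := sqr_ge0 K1; have := sqr_ge0 K2; clear; rewrite sqrrD; lra.
Qed.

Lemma sqnormv_col1 p (c : 'I_p) : sqnormv (col c (1%:M : 'M[C]_p)) = 1.
Proof.
rewrite /sqnormv (bigD1 c) //= big1 ?addr0 => [|a ac]; rewrite !mxE ?eqxx /=.
  by rewrite /sqnormc /= expr1n expr0n addr0.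
by rewrite (negbTE ac) /sqnormc /= expr0n addr0.
Qed.

Lemma sqnormv0 p : sqnormv (0 : 'cV[C]_p) = 0.
Proof. by rewrite /sqnormv big1 // => a _; rewrite mxE /sqnormc /= expr0n addr0. Qed.

Lemma transfer_bound (v vhat : R -> 'M[C]_(m1, m2)) (u uhat : R -> C -> 'M[C]_(m1 + m2))
  (l : R) :
  fundamental_solution v u -> fundamental_solution vhat uhat -> 0 <= l ->
  exists K : R, forall (eta : R) (phi : 'M[C]_(m2, m1)), 0 < eta ->
    weyl_summable u (zeta eta) phi -> weyl_summable uhat (zeta eta) phi ->
    forall a b, normc ((u l (zeta eta) *m J *m adjmx (uhat l (zeta (- eta)))) a b) <= K.
Proof.
move=> fu fuh l0; have [K1 K10 h1] := column_growth fu l; have [K2 K20 h2] :=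
  column_growth fuh l.
exists (m1%:R * (K1 + K2) + m2%:R * (K2 + K1)) => eta phi eta0 su suh a b.
have ll : 0 <= l <= l by rewrite l0 lexx.
have up (y : 'cV[C]_(m1 + m2)) : \sum_(a : 'I_(m1 + m2) | (a < m1)%N) sqnormc (y a 0) =
  sqnormv (usubmx y).
  by rewrite sum_dirac_upper; apply: eq_bigr => i _; rewrite mxE.
have down (y : 'cV[C]_(m1 + m2)) : \sum_(a : 'I_(m1 + m2) | (m1 <= a)%N) sqnormc (y a 0)
  = sqnormv (dsubmx y).
  by rewrite sum_dirac_lower; apply: eq_bigr => i _; rewrite mxE.
have all2 (y : 'cV[C]_(m1 + m2)) : sqnormv y <= 2 * \sum_a sqnormc (y a 0).
  by rewrite -/(sqnormv y) ler_peMl ?sqnormv_ge0 // ler1n.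
have sgn_le (a' : 'I_(m1 + m2)) (e : R) : - (e * dirac_sgn R a') <= `|e|.
  by rewrite (le_trans (ler_norm _)) // normrN normrM norm_dirac_sgn mulr1.
(* The dominating block of the initial column is a unit vector here and in [bpsi], so neither bound
   involves [phi]. *)
have bY c : sqnormv (col c (u l (zeta eta) *m col_mx 1%:M phi)) <= K1 * expR (- (2 * eta * l)).
  rewrite col_mulmx.
  apply: le_trans (h1 (fun a => a < m1)%N (- eta) eta (col c (col_mx 1%:M phi)) _ _ l ll) _.
  - by move=> i im; rewrite /dirac_sgn leqNgt im expr0 mulr1.
  - move=> x /andP[x0 _]; rewrite up colE sqnormv_vsub.
    by have := weyl_lower_le_upper fu eta0 su (delta_mx c 0) x0; clear; lra.
  rewrite up (_ : usubmx _ = col c 1%:M); last first.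
    by apply/colP => i; rewrite mxE mxE col_mxEu !mxE.
  by rewrite sqnormv_col1 mulr1 mulrN mulNr.
have bpsi c : sqnormv (col c (uhat l (zeta (- eta)) *m col_mx (adjmx phi) 1%:M)) <=
    K2 * expR (- (2 * eta * l)).
  rewrite col_mulmx.
  apply: le_trans (h2 (fun a => m1 <= a)%N (- eta) (- eta) (col c (col_mx (adjmx phi)
    1%:M)) _ _ l ll) _.
  - by move=> i im; rewrite /dirac_sgn im expr1 mulrN1 opprK.
  - move=> x /andP[x0 _]; rewrite down colE sqnormv_vsub.
    by have := weyl_upper_le_lower_conj fuh eta0 suh (delta_mx c 0) x0; clear; lra.
  rewrite down (_ : dsubmx _ = col c 1%:M); last first.
    by apply/colP => i; rewrite mxE mxE col_mxEd !mxE.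
  by rewrite sqnormv_col1 mulr1 mulrN mulNr.
(* The complementary factors need only the generic growth rate, with all components in [S]. *)
have bZ c : sqnormv (col c (u l (zeta eta) *m col_mx 0 1%:M)) <= K1 * expR (2 * eta * l).
  rewrite col_mulmx.
  apply: le_trans (h1 predT eta eta (col c (col_mx 0 1%:M)) _ _ l ll) _ => //.
    by move=> i _; rewrite -[leRHS]gtr0_norm.
  rewrite -[\sum_(_ | _) _]/(sqnormv _) (_ : col c _ = col_mx 0 (col c 1%:M)); last first.
    by apply/colP => i; rewrite mxE; case: (split_ordP i) => j ->; rewrite ?col_mxEu
      ?col_mxEd !mxE.
  by rewrite sqnormv_col sqnormv0 sqnormv_col1 add0r mulr1.
have bZh c : sqnormv (col c (uhat l (zeta (- eta)) *m col_mx 1%:M 0)) <= K2 * expR (2 *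
  eta * l).
  rewrite col_mulmx.
  apply: le_trans (h2 predT eta (- eta) (col c (col_mx 1%:M 0)) _ _ l ll) _ => //.
    by move=> i _; rewrite -[leRHS]gtr0_norm // -normrN.
  rewrite -[\sum_(_ | _) _]/(sqnormv _) (_ : col c _ = col_mx (col c 1%:M) 0); last first.
    by apply/colP => i; rewrite mxE; case: (split_ordP i) => j ->; rewrite ?col_mxEu
      ?col_mxEd !mxE.
  by rewrite sqnormv_col sqnormv0 sqnormv_col1 addr0 mulr1.
have -> : u l (zeta eta) *m J *m adjmx (uhat l (zeta (- eta))) =
    (u l (zeta eta) *m col_mx 1%:M phi) *m adjmx (uhat l (zeta (- eta)) *m col_mx 1%:M 0) +
    - ((u l (zeta eta) *m col_mx 0 1%:M) *m adjmx (uhat l (zeta (- eta)) *m col_mx (adjmx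
      phi) 1%:M)).
  have e : J = col_mx 1%:M phi *m row_mx 1%:M 0 - col_mx 0 1%:M *m row_mx phi 1%:M.
    rewrite !mul_col_row !mulmx1 !mul1mx !mulmx0 !mul0mx opp_block_mx add_block_mx.
    by rewrite !oppr0 !addr0 subrr add0r.
  rewrite !adjmxM !adjmx_col adjmxK !adjmx1 adjmx0 e mulmxBr mulmxBl.
  by rewrite !mulmxA.
rewrite mxE (le_trans (le_normcD _ _)) // lerD //.
  exact: mulmx_adj_bound.
rewrite mxE normcN addrC.
apply: (@mulmx_adj_bound _ _ _ _ _ _ _ (- (2 * eta * l))) => // c.
by rewrite opprK.
Qed.

End weyl_estimates.

(** * The transfer function *)

Section uniqueness.
Variables (R : realType) (m1 m2 : nat).
Local Notation C := R[i].
Local Notation normc := (@Normc.normc R).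
Local Notation J := (dirac_j R m1 m2).
Local Notation zeta eta := (Complex 0 eta : C).

Lemma sum_scalemxE p q (I : finType) (c : I -> C) (A : I -> 'M[C]_(p, q)) a b :
  (\sum_k c k *: A k) a b = \sum_k c k * A k a b.
Proof. by rewrite summxE; apply: eq_bigr => k _; rewrite mxE. Qed.

Definition transfer (u uhat : R -> C -> 'M[C]_(m1 + m2)) (eta x : R) :=
  u x (zeta eta) *m J *m adjmx (uhat x (zeta (- eta))).

(** The part of the x-derivative of [transfer] that is free of [eta]. It is linear in [A], which
    provides the hypothesis on [r] in [exp_dual_bound]. *)
Definition transfer_rhs (v vhat : R -> 'M[C]_(m1, m2)) (x : R) (A : 'M[C]_(m1 + m2)) :=
  'i%C *: (J *m (dirac_V v x *m A) - A *m dirac_V vhat x *m J).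

Lemma transfer_rhs_bound v vhat x (A : 'M[C]_(m1 + m2)) (S : R) a b :
  (forall c d, normc (A c d) <= S) ->
  normc (transfer_rhs v vhat x A a b) <=
  (potential_density v x + potential_density vhat x) * S.
Proof.
move=> hA; have S0 : 0 <= S := le_trans (normc_ge0 _) (hA a b).
rewrite mxE Normc.normcM (_ : normc 'i%C = 1) ?mul1r; last first.
  by rewrite /= expr0n expr1n add0r sqrtr1.
rewrite mxE (le_trans (le_normcD _ _)) // mulrDl lerD //.
  rewrite mul_dirac_jE Normc.normcM normc_real norm_dirac_sgn mul1r.
  apply: le_trans (ler_wpM2r S0 (normc_potential_row v x a)).
  rewrite mxE (le_trans (le_normc_sum _ _ _)) // mulr_suml; apply: ler_sum => c _.
  by rewrite Normc.normcM ler_wpM2l ?normc_ge0.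
rewrite mxE normcN mul_mx_dirac_jE Normc.normcM normc_real norm_dirac_sgn mulr1.
apply: le_trans (ler_wpM2r S0 (normc_potential_row vhat x b)).
rewrite mxE (le_trans (le_normc_sum _ _ _)) // mulr_suml; apply: ler_sum => c _.
rewrite Normc.normcM mulrC ler_pM ?normc_ge0 //.
by rewrite -{1}adj_dirac_V !mxE normc_conj.
Qed.

Lemma transfer_rhs_sum v vhat x (I : finType) (c : I -> R) (A : I -> 'M[C]_(m1 + m2)) :
  \sum_k (c k)%:C%C *: transfer_rhs v vhat x (A k) =
  transfer_rhs v vhat x (\sum_k (c k)%:C%C *: A k).
Proof.
rewrite /transfer_rhs mulmx_sumr mulmx_sumr !mulmx_suml -sumrB scaler_sumr.
apply: eq_bigr => k _; rewrite -!scalemxAr -!scalemxAl -scalerBr !scalerA.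
by rewrite mulrC.
Qed.

Section two_systems.
Variables (v vhat : R -> 'M[C]_(m1, m2)) (u uhat : R -> C -> 'M[C]_(m1 + m2)).
Hypotheses (fund : fundamental_solution v u) (fundhat : fundamental_solution vhat uhat).

Lemma transfer_mac l eta : mac 0 l (transfer u uhat eta).
Proof.
exact: (macM (macM (fundamental_mac fund l (zeta eta)) (mac_cst 0 l J))
  (mac_adj (fundamental_mac fundhat l (zeta (- eta))))).
Qed.

Lemma transfer0 eta : transfer u uhat eta 0 = J.
Proof. by rewrite /transfer (fund _).2 (fundhat _).2 adjmx1 mul1mx mulmx1. Qed.

Lemma transfer_derive eta : {ae leb R, forall x : R, 0 < x -> forall a b,
  cderive (fun t => transfer u uhat eta t a b) x
    (- (eta * (dirac_sgn R a - dirac_sgn R b))%:C%C * transfer u uhat eta x a b +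
     transfer_rhs v vhat x (transfer u uhat eta x) a b)}.
Proof.
apply: filterS2 (fundamental_derive fund (zeta eta)) (fundamental_derive fundhat (zeta (-
  eta))).
move=> x h1 h2 x0 a b.
apply: cderive_eq (mx_is_deriveM (mx_is_deriveM (h1 x0) (mx_is_derive_cst J x))
  (mx_is_derive_adj (h2 x0)) a b) _.
set A := transfer u uhat eta x.
rewrite (_ : _ *m _ + _ = dirac_G v (zeta eta) x *m A + A *m adjmx (dirac_G vhat (zeta (-
  eta)) x)); last first.
  by rewrite mulmx0 addr0 adjmxM /A /transfer !mulmxA.
have mxZE (c : C) (M : 'M[C]_(m1 + m2)) : (c *: M) a b = c * M a b by rewrite mxE.
have mxDE (M M' : 'M[C]_(m1 + m2)) : (M + M') a b = M a b + M' a b by rewrite mxE.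
have mxNE (M : 'M[C]_(m1 + m2)) : (- M) a b = - M a b by rewrite mxE.
rewrite mxDE dirac_G_mulE adj_dirac_G /= opprK -scalemxAr mxZE mulmxDr mxDE -scalemxAr mxZE.
rewrite (mulmxA A) !mul_mx_dirac_jE /transfer_rhs mxZE mxDE mxNE mul_dirac_jE mul_mx_dirac_jE.
have -> : (zeta eta) = 'i%C * eta%:C%C.
  by apply/eqP; rewrite eq_complex /=; apply/andP; split; apply/eqP; ring.
rewrite !rmorphN !rmorphM rmorphB /=.
have i2 : 'i%C * 'i%C = -1 :> C by rewrite -expr2 sqr_i.
set s := (dirac_sgn R b)%:C%C; set e := eta%:C%C; set B := A a b.
have -> : - 'i%C * ('i%C * e * (B * s) + (A *m dirac_V vhat x) a b * s) =
  - ('i%C * 'i%C) * e * B * s - 'i%C * ((A *m dirac_V vhat x) a b * s) by ring.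
by rewrite i2; ring.
Qed.

(* The transfer function is bounded along the whole imaginary axis and is the
   Laplace transform of a measure supported in [-2x, 2x]. *)
Lemma transfer_constant x : 0 <= x ->
  (forall eta : R, 0 < eta -> exists2 phi : 'M[C]_(m2, m1),
     weyl_summable u (zeta eta) phi & weyl_summable uhat (zeta eta) phi) ->
  transfer u uhat 1 x = transfer u uhat 0 x.
Proof.
move=> x0 hphi; apply/matrixP => a b.
have [K1 hK1] := transfer_bound fund fundhat x0.
have [K2 hK2] := transfer_bound fundhat fund x0.
(* Entry (a, b) of j N - N j is this difference times the entry of N; the bound 2 on it makes the
   support [-2x, 2x]. *)
pose lam (ab : 'I_(m1 + m2) * 'I_(m1 + m2)) := dirac_sgn R ab.1 - dirac_sgn R ab.2.
have hlam ab : `|lam ab| <= 2.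
  by rewrite (le_trans (ler_normB _ _)) // !norm_dirac_sgn; lra.
have w0 t : 0 <= potential_density v t + potential_density vhat t.
  by rewrite addr_ge0 ?potential_density_ge0.
have [K K0 hK] := exp_dual_bound x0
  (ac_densityD (potential_ac_density fund x) (potential_ac_density fundhat x)) hlam.
apply: (@exp_dual_const R (fun eta => transfer u uhat eta x a b) (2 * x) K
  (Num.max (Num.max K1 K2) (normc (transfer u uhat 0 x a b))) K0).
- move=> s B hB.
  rewrite (big_nth (0, 0)) big_mkord.
  apply: (hK 'I_(size s) (fun k => (nth (0, 0) s k).1) (fun k => (nth (0, 0) s k).2)
    (fun k ab t => transfer u uhat (nth (0, 0) s k).2 t ab.1 ab.2) _ _ B _ (a, b)).
  + by move=> k ab; exact: transfer_mac.
  + have : {ae leb R, forall t : R, forall k : 'I_(size s), 0 < t -> forall a b,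
      cderive (fun t' => transfer u uhat (nth (0, 0) s k).2 t' a b) t
      (- ((nth (0, 0) s k).2 * (dirac_sgn R a - dirac_sgn R b))%:C%C * transfer u uhat
        (nth (0, 0) s k).2 t a b +
       transfer_rhs v vhat t (transfer u uhat (nth (0, 0) s k).2 t) a b)}.
      by apply: filter_forall => k; exact: transfer_derive.
    apply: filterS => t ht /andP[t0 _].
    exists (fun (k : 'I_(size s)) ab => transfer_rhs v vhat t (transfer u uhat (nth (0,
      0) s k).2 t) ab.1 ab.2).
      by move=> k ab; exact: ht.
    move=> c' S hS ab.
    have := @transfer_rhs_bound v vhat t
      (\sum_(k < size s) (c' k)%:C%C *: transfer u uhat (nth (0, 0) s k).2 t) S ab.1 ab.2.
    rewrite -transfer_rhs_sum sum_scalemxE; apply.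
    move=> c d; rewrite sum_scalemxE; exact: (hS (c, d)).
  + move=> ab sg hsg; rewrite /=.
    (* At x = 0 the transfer function is j for every parameter, so the combination reduces to the
       scalar one bounded by [B]. *)
    under eq_bigr do rewrite transfer0.
    rewrite -mulr_suml Normc.normcM dirac_jE !mxE.
    rewrite -rmorph_sum normc_real.
    have hB' := hB sg hsg; rewrite (big_nth (0, 0)) big_mkord in hB'.
    apply: (le_trans _ hB'); rewrite ler_piMr //.
    case: eqP => _; last by rewrite mulr0n Normc.normc0.
    by rewrite mulr1n normc_real norm_dirac_sgn.
move=> eta; rewrite !le_max.
(* At 0 there is no Weyl solution, so that value is part of the bound itself. For negative [eta] the
   adjoint exchanges the two systems and makes the parameter positive. *)
have [eta0|eta0|->] := ltgtP eta 0; last by rewrite lexx !orbT.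
  have eta0' : 0 < - eta by rewrite oppr_gt0.
  have [phi h1 h2] := hphi _ eta0'.
  have := hK2 (- eta) phi eta0' h2 h1 b a; rewrite opprK => h.
  rewrite (_ : transfer u uhat eta x = adjmx (uhat x (zeta (- eta)) *m J *m adjmx (u x
    (zeta eta)))).
    by rewrite !mxE normc_conj; move: h; rewrite mxE => ->; rewrite orbT.
  by rewrite !adjmxM adjmxK adj_dirac_j mulmxA.
by have [phi h1 h2] := hphi _ eta0; rewrite (hK1 eta phi eta0 h1 h2).
Qed.

End two_systems.

Lemma near_pos_cderive (f g : R -> C) x z : 0 < x -> (forall t, 0 < t -> f t = g t) ->
  cderive f x z -> cderive g x z.
Proof.
move=> x0 fg [h1 h2].
have near_fg : \forall t \near x, f t = g t.
  by apply: filterS (lt_nbhsr x0) => t t0; exact: fg.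
by split; [apply: near_eq_is_derive h1 | apply: near_eq_is_derive h2];
  apply: filterS near_fg => t ->.
Qed.

Lemma cderive_unique (f : R -> C) x z w : cderive f x z -> cderive f x w -> z = w.
Proof.
move=> [[_ h1] [_ h2]] [[_ h3] [_ h4]].
by move: h1 h2; rewrite {}h3 {}h4; case: z w => ? ? [? ?] /= -> ->.
Qed.

(** V anticommutes with j: for equal signs the entry equals its own negative. *)
Lemma dirac_V_diag (v : R -> 'M[C]_(m1, m2)) x a b :
  dirac_sgn R a = dirac_sgn R b -> dirac_V v x a b = 0.
Proof.
move=> ab; have /matrixP /(_ a b) := dirac_jV_j v x.
have mxNE (M : 'M[C]_(m1 + m2)) : (- M) a b = - M a b by rewrite mxE.
rewrite mul_mx_dirac_jE mul_dirac_jE mxNE ab mulrAC -rmorphM -expr2 /dirac_sgn sqrr_sign mul1r.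
by move/eqP; rewrite -addr_eq0 -mulr2n mulrn_eq0 /= => /eqP.
Qed.

(** * From a constant transfer function to equal potentials *)

Section commuting_transfer.
Variables (v vhat : R -> 'M[C]_(m1, m2)) (u uhat : R -> C -> 'M[C]_(m1 + m2)).
Hypotheses (fund : fundamental_solution v u) (fundhat : fundamental_solution vhat uhat).
Hypothesis const : forall x, 0 <= x -> transfer u uhat 1 x = transfer u uhat 0 x.
Local Notation T := (transfer u uhat 0).

Lemma transfer0_derive : {ae leb R, forall x : R, 0 < x ->
  mx_is_derive T x (transfer_rhs v vhat x (T x))}.
Proof.
apply: filterS (transfer_derive fund fundhat 0) => x h x0 a b.
by apply: cderive_eq (h x0 a b) _; rewrite mul0r rmorph0 oppr0 mul0r add0r.
Qed.

(* Comparing the derivatives at the spectral parameters 0 and i. *)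
Lemma transfer_offdiag0 x a b : 0 <= x -> dirac_sgn R a != dirac_sgn R b -> T x a b = 0.
Proof.
move=> x0 ab; apply/sqnormc_eq0/eqP; rewrite eq_le sqnormc_ge0 andbT.
have T0 : sqnormc (T 0 a b) = 0.
  have -> : T 0 a b = 0.
    rewrite (transfer0 fund fundhat) dirac_jE !mxE; case: eqP => [e|_]; last by rewrite mulr0n.
    by move: ab; rewrite e eqxx.
  by rewrite /sqnormc /= expr0n addr0.
(* Comparing derivatives shows that the entry vanishes at almost every t only. Its squared modulus
   then has zero derivative almost everywhere, which gives vanishing at every point. *)
rewrite -[leRHS]T0; apply: (@ac_nonincreasing R 0 x (fun t => sqnormc (T t a b))) => //.
  exact: ac_sqnormc (transfer_mac fund fundhat x 0 a b).
apply: filterS2 (transfer_derive fund fundhat 1) transfer0_derive => t h1 h2 /andP[t0 _].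
have d1 := near_pos_cderive t0 (fun s s0 => congr1 (fun A : 'M[C]_(m1 + m2) => A a b)
  (const (ltW s0))) (h1 t0 a b).
have := cderive_unique d1 (h2 t0 a b).
rewrite (const (ltW t0)) => /eqP; rewrite -subr_eq0 addrK mulf_eq0 oppr_eq0 mul1r.
rewrite -(rmorph0 (real_complex R)) (inj_eq (@complexI R)) subr_eq0 (negbTE ab) /= => /eqP Tt.
exists 0 => //; apply: is_derive_eq (is_derive_sqnormc (h2 t0 a b)) _.
by rewrite Tt rmorph0 mul0r mulr0.
Qed.

(** Where the signs differ, the entry of [T] vanishes identically and so does its derivative. Where
    they agree, every summand pairs a block-diagonal [T] with a block-off-diagonal potential and is
    0. *)
Lemma transfer_rhs0 : {ae leb R, forall x : R, 0 < x -> transfer_rhs v vhat x (T x) = 0}.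
Proof.
apply: filterS transfer0_derive => x h x0; apply/matrixP => a b; rewrite [RHS]mxE.
have [ab|ab] := eqVneq (dirac_sgn R a) (dirac_sgn R b); last first.
  apply: cderive_unique (h x0 a b) (near_pos_cderive x0 _ (cderive_cst x 0)) => t t0.
  by rewrite transfer_offdiag0 // ltW.
have mxNE (M : 'M[C]_(m1 + m2)) : (- M) a b = - M a b by rewrite mxE.
rewrite /transfer_rhs mxE [X in _ * X]mxE mxNE mul_dirac_jE mul_mx_dirac_jE.
rewrite [(dirac_V v x *m _) a b]mxE big1 => [|c _]; last first.
  have [ac|ac] := eqVneq (dirac_sgn R a) (dirac_sgn R c).
    by rewrite dirac_V_diag ?mul0r.
  by rewrite (@transfer_offdiag0 x c b) ?(ltW x0) ?mulr0 // -ab eq_sym.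
rewrite [(_ *m dirac_V vhat x) a b]mxE big1 => [|c _]; last first.
  have [ac|ac] := eqVneq (dirac_sgn R a) (dirac_sgn R c).
    by rewrite (@dirac_V_diag vhat x c b) ?mulr0 // -ac.
  by rewrite transfer_offdiag0 ?mul0r // ltW.
by rewrite mulr0 mul0r subrr mulr0.
Qed.

Lemma transfer_trivial x : 0 <= x -> T x = J.
Proof.
move=> x0; rewrite -(transfer0 fund fundhat 0); apply: (mac_constant x0 (transfer_mac
  fund fundhat x 0)).
by apply: filterS2 transfer0_derive transfer_rhs0 => t h1 h2 /andP[t0 _];
  rewrite -(h2 t0); exact: h1.
Qed.

Lemma potential_eq : {ae leb R, forall x : R, 0 < x -> v x = vhat x}.
Proof.
apply: filterS transfer_rhs0 => x h x0; have := h x0.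
rewrite /transfer_rhs transfer_trivial ?(ltW x0) // mulmxA !dirac_jV_j => /eqP.
rewrite scaler_eq0 eq_complex /= oner_eq0 andbF /= subr_eq0 eqr_opp => /eqP.
by move=> /(congr1 ursubmx); rewrite /dirac_V !block_mxKur.
Qed.

End commuting_transfer.
End uniqueness.

Unset Implicit Arguments.
Set Strict Implicit.

Theorem theorem1p4 (R : realType) (m1 m2 : nat)
    (hm1 : (1 <= m1)%N) (hm2 : (1 <= m2)%N)
    (v vhat : R -> 'M[R[i]]_(m1, m2))
    (v_meas : mx_measurable `[0, +oo[ v)
    (v_l2 : mx_locally_square_summable v)
    (vhat_meas : mx_measurable `[0, +oo[ vhat)
    (vhat_l2 : mx_locally_square_summable vhat)
    (phi phihat : R[i] -> 'M[R[i]]_(m2, m1))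
    (phi_weyl : weyl_function v phi)
    (phihat_weyl : weyl_function vhat phihat)
    (same_weyl : forall z, upper_half_plane z -> phi z = phihat z) :
  {ae leb R, forall x : R, 0 <= x -> v x = vhat x}.
Proof.
case: phi_weyl => _ [u fund hu]; case: phihat_weyl => _ [uhat fundhat huhat].
have const x : 0 <= x -> transfer u uhat 1 x = transfer u uhat 0 x.
  move=> x0; apply: (transfer_constant fund fundhat x0) => eta eta0.
  exists (phi (Complex 0 eta)); first exact: hu.
  by rewrite same_weyl //; exact: huhat.
apply: filterS2 (potential_eq fund fundhat const) (ae_neq 0) => x h xn0.
by rewrite le_eqVlt eq_sym (negbTE xn0) => /h.
Qed.
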